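(* Let $(T_\xi)$ be a family of operators $T_\xi\colon\mathcal H\to\mathcal H$, with $\xi\sim\mathcal D$, such that $T_\xi$ is nonexpansive for $\mathcal D$-almost all $\xi$ and, for each $x\in\mathcal H$, the map $\xi\mapsto T_\xi x$ is measurable and Bochner integrable. Define $Tx=\mathbb E_{\xi\sim\mathcal D}[T_\xi x]$ and assume $\mathrm{Fix}(T)\neq\emptyset$. Assume that for some $p_0\in\mathrm{Fix}(T)$, $\mathbb E[\|(T_\xi-T)p_0\|^2]\le\sigma_*^2<+\infty$. Let $(\lambda_k)_{k\ge0}\subset(0,1)$ satisfy $\sum_{k=0}^\infty\lambda_k^2<+\infty$ and $\sum_{k=0}^\infty\lambda_k=+\infty$. Let $x_0\in\mathcal H$ and let $(x_k)$ be the random iterates of the stochastic Krasnoselskii-Mann algorithm $x_{k+1}=(1-\lambda_k)x_k+\lambda_kT_{\xi_k}(x_k)$, where $\xi_0,\xi_1,\dots$ are drawn independently from $\mathcal D$. Then, almost surely: 1. $\|Tx_k-x_k\|$ converges to $0$; and 2. $x_k$ converges weakly to an element of $\mathrm{Fix}(T)$.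
   Context: $\mathcal H$ is a real separable Hilbert space with norm $\|\cdot\|$, and $\mathcal D$ is a probability distribution. An operator $S$ is nonexpansive if $\|Sx-Sy\|\le\|x-y\|$ for all $x,y\in\mathcal H$. $\mathrm{Fix}(T)=\{x\colon Tx=x\}$. The starting point $x_0$ is a fixed (deterministic) point. The weak limit may be random (depend on the realization of $(\xi_k)$). *)

(* Defs.v *)
From HB Require Import structures.
From mathcomp Require Import all_boot all_order all_algebra finmap.
From mathcomp Require Import all_classical all_reals all_analysis.

Set Implicit Arguments.
Unset Strict Implicit.
Unset Printing Implicit Defensive.

Import Order.TTheory GRing.Theory Num.Theory.
Import numFieldNormedType.Exports.

Local Open Scope classical_set_scope.
Local Open Scope ring_scope.

Definition separable_space (X : topologicalType) : Prop :=
  exists2 A : set X, countable A & dense A.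

(* A real Hilbert space is a complete normed space H whose norm is the one
   given by an inner product dot. *)
Definition norm_of_dot (R : realType) (H : normedModType R)
    (dot : {dot H for @idfun R}) : Prop :=
  forall x : H, `|x| ^+ 2 = dot x x.

Definition weakly_converges (R : realType) (H : normedModType R)
    (dot : {dot H for @idfun R}) (u : nat -> H) (l : H) : Prop :=
  forall y : H, (fun k => dot (u k) y) @ \oo --> dot l y.

Definition nonexpansive (R : realType) (H : normedModType R)
    (S : H -> H) : Prop :=
  forall x y : H, `|S x - S y| <= `|x - y|.

Definition fixed_points (X : Type) (S : X -> X) : set X := [set x | S x = x].

Definition borel_measurable (d : measure_display) (E : measurableType d)
    (X : ptopologicalType) (f : E -> X) : Prop :=
  measurable_fun [set: E] (f : E -> g_sigma_algebraType (@open X)).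

Section Bochner.
Context (R : realType) (H : normedModType R).
Context (d : measure_display) (E : measurableType d) (D : probability E R).

Definition simple_function (s : E -> H) : Prop :=
  finite_set (range s) /\ borel_measurable s.

(* D is finite, so fine loses nothing here, and every simple function is
   integrable. *)
Definition simple_integral (s : E -> H) : H :=
  \sum_(v \in range s) fine (D (s @^-1` [set v])) *: v.

Definition bochner_approx (f : E -> H) (s : nat -> E -> H) : Prop :=
  [/\ forall n, simple_function (s n),
      {ae D, forall e, (fun n => s n e) @ \oo --> f e} &
      (fun n => (\int[D]_e (`|f e - s n e|)%:E)%E) @ \oo --> 0%E].

Definition bochner_integrable (f : E -> H) : Prop :=
  exists s, bochner_approx f s.

(* For Bochner integrable f and complete H, the limit v exists and does not
   depend on s; otherwise the value may be the default 0. *)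
Definition bochner_integral (f : E -> H) : H :=
  xget 0 [set v | exists2 s, bochner_approx f s &
                    (fun n => simple_integral (s n)) @ \oo --> v].

Definition mean_operator (Tf : E -> H -> H) (x : H) : H :=
  bochner_integral (fun e => Tf e x).

End Bochner.

Definition mutually_independent (R : realType)
    (d d' : measure_display) (Omega : measurableType d) (E : measurableType d')
    (P : probability Omega R) (xi : nat -> {RV P >-> E}) : Prop :=
  forall (J : {fset nat}) (A : nat -> set E),
    (forall i, measurable (A i)) ->
    P (\bigcap_(i in [set` J]) (xi i @^-1` A i)) =
    (\prod_(i <- J) P (xi i @^-1` A i))%E.

(* The random iterate x_k at the outcome w. *)
Fixpoint skm (R : realType) (H : normedModType R) (E Omega : Type)
    (Tf : E -> H -> H) (lambda : nat -> R) (xi : nat -> Omega -> E) (x0 : H)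
    (k : nat) (w : Omega) : H :=
  if k is j.+1 then
    let x := skm Tf lambda xi x0 j w in
    (1 - lambda j) *: x + lambda j *: Tf (xi j w) x
  else x0.

(* Main.v *)
Require Import Defs.
From HB Require Import structures.
From mathcomp Require Import all_boot all_order all_algebra finmap.
From mathcomp Require Import all_classical all_reals all_analysis.
From mathcomp Require Import measurable_realfun ring lra.

(* Let p be a fixed point of T, V = T_xi p - p and U = T_xi y - y.  Expanding
   |y + l U - p|^2 and using |(y - p) + (U - V)| <= |y - p| gives
     |y + l U - p|^2 <= |y - p|^2 + 2 l <V, y - p> - c l |U - V|^2 + C l^2 |V|^2.
   The mean of U - V is T y - y, so taking expectations bounds E |x_k - p|^2 and
   shows that sum l_k |T x_k - x_k|^2 is finite almost surely.  The partial sums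
   of l_k <V_k, x_k - p> and of l_k (T_xi_k x_k - T x_k) are martingales bounded
   in L^2, hence Cauchy almost surely by the maximal inequality.  The first one
   turns the inequality above into the convergence of |x_k - p|, simultaneously
   for p in a countable dense subset of Fix T and then for all p.  The second one
   controls the oscillation of |T x_k - x_k| between two times j < k by
   2 sum_(j <= i < k) l_i |T x_i - x_i| + o(1), which forces this residual to
   tend to 0.  The weak limit along an ultrafilter is a fixed point by
   demiclosedness, and the convergence of |x_k - p| for two such limits shows
   that it does not depend on the ultrafilter. *)

Set Implicit Arguments.
Unset Strict Implicit.
Unset Printing Implicit Defensive.

Import Order.TTheory GRing.Theory Num.Theory.
Import numFieldNormedType.Exports.

Local Open Scope classical_set_scope.
Local Open Scope ring_scope.

(** * Real Hilbert spaces *)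

(** Second moments are assumed at one fixed point only, and nonexpansiveness carries them elsewhere:
    the noise at y has norm at most 2 |y - p| plus that of the noise at p, so a bound on E |x_k -
    p|^2 bounds all the variances that occur. The one-step inequality has c > 0 and C finite because
    the steps stay below some [kappa] < 1, which square summability provides. Measurability is given
    in the sample for each fixed point x; measurability along a random point follows from
    nonexpansiveness in x and separability, and makes the iterates random variables. Tonelli's
    theorem stands in for conditional expectations: the past and xi_k are independent, so their
    joint law is a product and the past can be frozen while the fresh sample is integrated. Vectors
    are integrated only through inner products with fixed vectors, and the Bochner integral enters
    through that one identity. *)

Section Dot.
Context (R : realType) (H : normedModType R) (dot : {dot H for @idfun R}).
Hypothesis hdot : norm_of_dot dot.
Implicit Types x y z : H.

Lemma dotDl x y z : dot (x + y) z = dot x z + dot y z.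
Proof. exact: linearDl. Qed.

Lemma dotZl (a : R) x y : dot (a *: x) y = a * dot x y.
Proof. exact: linearZl_LR. Qed.

Lemma dotC x y : dot x y = dot y x.
Proof. by rewrite hermC expr0 mul1r. Qed.

Lemma dotDr x y z : dot x (y + z) = dot x y + dot x z.
Proof. by rewrite !(dotC x) dotDl. Qed.

Lemma dotZr (a : R) x y : dot x (a *: y) = a * dot x y.
Proof. by rewrite !(dotC x) dotZl. Qed.

Lemma dotNl x y : dot (- x) y = - dot x y.
Proof. by rewrite -scaleN1r dotZl mulN1r. Qed.

Lemma dotNr x y : dot x (- y) = - dot x y.
Proof. by rewrite !(dotC x) dotNl. Qed.

Lemma dot0l x : dot 0 x = 0.
Proof. by rewrite -(scale0r x) dotZl mul0r. Qed.

Definition dotE := (dotDl, dotDr, dotNl, dotNr, dotZl, dotZr).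

Lemma sqr_normD x y : `|x + y| ^+ 2 = `|x| ^+ 2 + 2 * dot x y + `|y| ^+ 2.
Proof. rewrite !hdot !dotE (dotC y x); ring. Qed.

Lemma sqr_normB x y : `|x - y| ^+ 2 = `|x| ^+ 2 - 2 * dot x y + `|y| ^+ 2.
Proof. rewrite !hdot !dotE (dotC y x); ring. Qed.

Lemma cauchy_schwarz x y : dot x y <= `|x| * `|y|.
Proof.
have [->|x0] := eqVneq x 0; first by rewrite dot0l normr0 mul0r.
have [->|y0] := eqVneq y 0; first by rewrite dotC dot0l normr0 mulr0.
have nx : 0 < `|x| by rewrite normr_gt0.
have ny : 0 < `|y| by rewrite normr_gt0.
have := sqr_ge0 (`| `|y| *: x - `|x| *: y|).
rewrite sqr_normB !dotE !normrZ !normr_id => h.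
have : 0 <= 2 * (`|x| * `|y|) * (`|x| * `|y| - dot x y) by nra.
by rewrite pmulr_rge0 ?subr_ge0// !mulr_gt0.
Qed.

Lemma normr_dot x y : `|dot x y| <= `|x| * `|y|.
Proof.
by rewrite ler_norml cauchy_schwarz andbT lerNl -dotNl -(normrN x) cauchy_schwarz.
Qed.

Lemma dot_continuous y : continuous (fun x => dot x y).
Proof.
move=> x; apply/cvgrPdist_le => e e0.
near=> z; rewrite -dotNl -dotDl (le_trans (normr_dot _ _))//.
have : `|x - z| <= e / (`|y| + 1).
  by near: z; apply: cvgr_dist_le; rewrite ?divr_gt0//; exact: cvg_id.
move=> /(ler_wpM2r (normr_ge0 y)) /le_trans; apply.
rewrite mulrAC ler_pdivrMr ?ler_pM2l ?lerDl// ltr_wpDl//.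
Unshelve. all: by end_near. Qed.

Lemma dot_inj x y : (forall z, dot x z = dot y z) -> x = y.
Proof.
move=> h; apply/eqP; rewrite -subr_eq0 -normr_eq0 -sqrf_eq0 hdot.
by rewrite dotDl dotNl h subrr.
Qed.

End Dot.

(* Identities between vectors reduce to ring identities between inner products. *)
Ltac dot_ring hdot := apply: (dot_inj hdot) => ?; rewrite ?(dotE _); ring.

(** * Weak convergence *)

(** The choice t = - a / (b + 1) makes the quadratic negative unless a = 0; the denominator b + 1
    also covers the degenerate case b = 0. *)
Lemma quadratic_ge0_lin0 (R : realFieldType) (a b : R) :
  (forall t, 0 <= 2 * t * a + t ^+ 2 * b) -> a = 0.
Proof.
move=> h; have b0 : 0 <= b by have := h 1; have := h (- 1); nra.
have b1 : 0 < b + 1 by lra.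
have := h (- (a / (b + 1))).
have -> : 2 * - (a / (b + 1)) * a + (- (a / (b + 1))) ^+ 2 * b =
          - (a ^+ 2 * (b + 2)) / (b + 1) ^+ 2 by field; lra.
rewrite pmulr_lge0 ?invr_gt0 ?exprn_gt0// oppr_ge0 pmulr_lle0; last lra.
by move=> a0; apply/eqP; rewrite -sqrf_eq0 eq_le a0 sqr_ge0.
Qed.

(** Compactness of a segment gives a cluster point, and for an ultrafilter a cluster point is a
    limit: a set or its complement always belongs to [F]. *)
Lemma ultra_bounded_cvg (R : realType) (T : Type) (F : set_system T)
    (u : T -> R) (B : R) :
  UltraFilter F -> (forall t, `|u t| <= B) -> cvg (u @ F).
Proof.
move=> FU uB.
have FI : F (u @^-1` `[- B, B]).
  by apply: filterE => t /=; rewrite in_itv/= -ler_norml.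
have [l [_ lF]] := @segment_compact _ (- B) B (u @ F) _ FI.
apply/cvg_ex; exists l => V Vl.
have [//|FV] := in_ultra_setVsetC (u @^-1` V) FU.
by have [z []] := lF (~` V) V FV Vl.
Qed.

Section WeakConvergence.
Context (R : realType) (H : completeNormedModType R).
Context (dot : {dot H for @idfun R}) (hdot : norm_of_dot dot).

(* The representing vector minimises |z|^2 - 2 phi z; by the parallelogram law a
   minimising sequence is Cauchy. *)
Lemma riesz (phi : H -> R) (B : R) :
  (forall y z, phi (y + z) = phi y + phi z) ->
  (forall a z, phi (a *: z) = a * phi z) ->
  (forall z, `|phi z| <= B * `|z|) ->
  exists l, forall y, phi y = dot l y.
Proof.
move=> phiD phiZ phiB.
pose J (z : H) : R := `|z| ^+ 2 - 2 * phi z.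
have J_ge z : - B ^+ 2 <= J z.
  have := phiB z; rewrite ler_norml => /andP[_ h].
  by rewrite /J; have := sqr_ge0 (`|z| - B); nra.
pose S := range J.
have S_inf : has_inf S.
  by split; [exists (J 0), 0 | exists (- B ^+ 2) => _ [z _ <-]].
pose m := inf S.
have mJ z : m <= J z by apply: ge_inf; [exact: S_inf.2 | exists z].
have /choice[z zm] n : exists z, J z < m + n.+1%:R^-1.
  have n0 : 0 < n.+1%:R^-1 :> R by rewrite invr_gt0.
  by have [_ [z _ <-] hz] := inf_adherent n0 S_inf; exists z.
have mid y w : `|y - w| ^+ 2 <= 2 * (J y - m) + 2 * (J w - m).
  have := mJ (2^-1 *: (y + w)).
  rewrite /J phiZ phiD normrZ ger0_norm ?invr_ge0// exprMn.
  by rewrite (sqr_normD hdot) (sqr_normB hdot); lra.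
have zcvg : cvgn z.
  apply/cauchy_cvgP/cauchy_exP => e e0 /=.
  near \oo => N.
  exists (z N), N => // n /= Nn.
  rewrite -ball_normE /=.
  rewrite -ltr_sqr ?nnegrE ?(ltW e0)//.
  have Ne : N.+1%:R^-1 < e ^+ 2 / 4.
    by near: N; apply: near_infty_natSinv_lt (PosNum _); rewrite divr_gt0 ?exprn_gt0.
  have nN : n.+1%:R^-1 <= N.+1%:R^-1 :> R.
    by rewrite lef_pV2 ?posrE// ler_nat ltnS.
  apply: le_lt_trans (mid _ _) _.
  move: (zm N) (zm n) Ne nN.
  by move: (J (z N)) (J (z n)) (N.+1%:R^-1) (n.+1%:R^-1) => a b c d; lra.
exists (lim (z @ \oo)) => y; apply/esym/eqP; rewrite -subr_eq0; apply/eqP.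
(* First variation at the limit: [m <= J (z n + t *: y)] and [J (z n) < m + n.+1%:R^-1] leave, as n
   grows, a nonnegative quadratic in t whose linear coefficient is the defect of the representation
   at y. *)
apply: (@quadratic_ge0_lin0 _ _ (`|y| ^+ 2)) => t.
have dcvg : dot (z n) y @[n --> \oo] --> dot (lim (z @ \oo)) y.
  exact: (cvg_comp _ _ zcvg (@dot_continuous _ _ _ hdot y _)).
have icvg : (n.+1%:R^-1 : R) @[n --> \oo] --> 0 by exact: cvg_harmonic.
have hcvg : n.+1%:R^-1 + (2 * t * (dot (z n) y - phi y) + t ^+ 2 * `|y| ^+ 2)
    @[n --> \oo] -->
    0 + (2 * t * (dot (lim (z @ \oo)) y - phi y) + t ^+ 2 * `|y| ^+ 2).
  apply: cvgD => //; apply: cvgD; last exact: cvg_cst.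
  by apply: cvgM; [exact: cvg_cst | apply: cvgB => //; exact: cvg_cst].
rewrite -[leRHS]add0r; apply: (ler_cvg_to (cvg_cst 0) hcvg); apply: nearW => n.
have := mJ (z n + t *: y); have := zm n.
rewrite /J phiD phiZ (sqr_normD hdot) (dotZr dot) normrZ exprMn real_normK ?num_real//.
by move: (n.+1%:R^-1) => c; lra.
Unshelve. all: by end_near. Qed.

(** Weak compactness of balls without extracting subsequences: along an ultrafilter each bounded
    scalar sequence <x_k, y> converges, and its limit is linear in y and bounded by B |y|, hence
    represented by a vector. *)
Lemma ultra_weak_limit (F : set_system nat) (x : nat -> H) (B : R) :
  UltraFilter F -> (forall k, `|x k| <= B) ->
  exists l, forall y, dot (x k) y @[k --> F] --> dot l y.
Proof.
move=> FU xB.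
have dB y k : `|dot (x k) y| <= B * `|y|.
  by rewrite (le_trans (normr_dot hdot _ _))// ler_wpM2r.
have dcvg y : cvg (dot (x k) y @[k --> F]).
  exact: ultra_bounded_cvg (dB y).
have [||z|l hl] := @riesz (fun y => lim (dot (x k) y @[k --> F])) B.
- move=> y z; apply: cvg_lim => //.
  under eq_fun do rewrite (dotDr dot).
  exact: cvgD (dcvg y) (dcvg z).
- move=> a z; apply: cvg_lim => //.
  under eq_fun do rewrite (dotZr dot).
  exact: cvgM (cvg_cst _) (dcvg z).
- rewrite ler_norml; apply/andP; split.
    apply: limr_ge => //; apply: nearW => k.
    by have := dB z k; rewrite ler_norml => /andP[].
  apply: limr_le => //; apply: nearW => k.
  by have := dB z k; rewrite ler_norml => /andP[].
by exists l => y; rewrite -hl; exact: dcvg.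
Qed.

(** On one side |x_k - T l| <= r_k + |x_k - l|; on the other, |x_k - T l|^2 expanded around l equals
    |x_k - l|^2 - 2 <x_k - l, T l - l> + |T l - l|^2. Both r_k and the inner product tend to 0, so
    |T l - l|^2 is squeezed to 0. *)
Lemma demiclosed (F : set_system nat) (T : H -> H) (x : nat -> H) (l : H) (B : R) :
  ProperFilter F -> nonexpansive T -> (forall k, `|x k| <= B) ->
  `|T (x k) - x k| @[k --> F] --> 0 ->
  (forall y, dot (x k) y @[k --> F] --> dot l y) ->
  T l = l.
Proof.
move=> FF Tne xB rF wF.
apply/eqP; rewrite -subr_eq0 -normr_eq0 -sqrf_eq0 eq_le sqr_ge0 andbT.
pose r k := `|T (x k) - x k|.
have h k : `|T l - l| ^+ 2 <=
    2 * (dot (x k) (T l - l) - dot l (T l - l)) +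
    (r k * r k + r k * (2 * (B + `|l|))).
  have h1 : `|x k - T l| <= r k + `|x k - l|.
    rewrite /r (distrC (T _)) (le_trans (ler_distD (T (x k)) _ _))// lerD2l.
    exact: Tne.
  have h2 : `|x k - l| <= B + `|l|.
    by rewrite (le_trans (ler_normB _ _))// lerD2r.
  have : x k - T l = (x k - l) - (T l - l) by rewrite opprB addrA subrK.
  move/(congr1 (fun z => `|z| ^+ 2)); rewrite (sqr_normB hdot (x k - l)).
  rewrite (dotDl dot (x k)) (dotNl dot).
  have : 0 <= r k by exact: normr_ge0.
  have := normr_ge0 (x k - T l); have := normr_ge0 (x k - l).
  nra.
have hcvg : 2 * (dot (x k) (T l - l) - dot l (T l - l)) +
    (r k * r k + r k * (2 * (B + `|l|))) @[k --> F] -->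
    2 * (dot l (T l - l) - dot l (T l - l)) +
    (0 * 0 + 0 * (2 * (B + `|l|))).
  apply: cvgD; first by apply: cvgM; [exact: cvg_cst|apply: cvgB => //; exact: cvg_cst].
  by apply: cvgD; apply: cvgM => //; exact: cvg_cst.
suff : `|T l - l| ^+ 2 <= 2 * (dot l (T l - l) - dot l (T l - l)) +
    (0 * 0 + 0 * (2 * (B + `|l|))) by rewrite subrr mulr0 !mul0r !addr0.
by apply: (ler_cvg_to (cvg_cst _) hcvg); exact: nearW.
Qed.

Lemma opial (T : H -> H) (x : nat -> H) :
  nonexpansive T -> fixed_points T !=set0 ->
  (forall p, fixed_points T p -> cvgn (fun k => `|x k - p|)) ->
  `|T (x k) - x k| @[k --> \oo] --> 0 ->
  exists2 p, fixed_points T p & weakly_converges dot x p.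
Proof.
move=> Tne [q Fq] xcvg rcvg.
have [B xB] : exists B, forall k, `|x k| <= B.
  have /cvg_seq_bounded := xcvg _ Fq.
  case=> M [_ hM]; exists (M + 1 + `|q|) => k.
  have := hM (M + 1) (ltr_pwDr ltr01 (lexx M)) k I; rewrite /= normr_id => h.
  by rewrite -lerBlDr (le_trans _ h)// lerB_dist.
have fixU (F : set_system nat) : UltraFilter F -> \oo `<=` F -> exists2 l,
    fixed_points T l & forall y, dot (x k) y @[k --> F] --> dot l y.
  move=> FU Foo; have [l wl] := ultra_weak_limit FU xB.
  exists l => //; apply: demiclosed xB _ wl => //.
  by apply: cvg_trans rcvg; exact: cvg_app.
have uniqU F G l m : UltraFilter F -> UltraFilter G -> \oo `<=` F -> \oo `<=` G ->
    fixed_points T l -> fixed_points T m ->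
    (forall y, dot (x k) y @[k --> F] --> dot l y) ->
    (forall y, dot (x k) y @[k --> G] --> dot m y) -> l = m.
  move=> FU GU Foo Goo Fl Fm wl wm.
  pose c := lim (`|x k - m| @[k --> \oo]) ^+ 2 - lim (`|x k - l| @[k --> \oo]) ^+ 2.
  (* By polarization <x_k, l - m> is a combination of |x_k - m|^2 and |x_k - l|^2, so it converges
     along the whole sequence; its limit is then both <l, l - m> and <m, l - m>. *)
  have dc : dot (x k) (l - m) @[k --> \oo] --> 2^-1 * (c + `|l| ^+ 2 - `|m| ^+ 2).
    have -> : (fun k => dot (x k) (l - m)) = fun k =>
       2^-1 * ((`|x k - m| ^+ 2 - `|x k - l| ^+ 2) + `|l| ^+ 2 - `|m| ^+ 2).
      apply/funext => k; rewrite !(sqr_normB hdot) (dotDr dot) (dotNr dot); lra.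
    apply: cvgM; first exact: cvg_cst.
    apply: cvgB; last exact: cvg_cst.
    apply: cvgD; last exact: cvg_cst.
    by apply: cvgB; apply: cvgM; exact: xcvg.
  have eF : dot l (l - m) = 2^-1 * (c + `|l| ^+ 2 - `|m| ^+ 2).
    apply: (cvg_unique _ (wl (l - m))) => //.
    by apply: cvg_trans dc; exact: cvg_app.
  have eG : dot m (l - m) = 2^-1 * (c + `|l| ^+ 2 - `|m| ^+ 2).
    apply: (cvg_unique _ (wm (l - m))) => //.
    by apply: cvg_trans dc; exact: cvg_app.
  apply/eqP; rewrite -subr_eq0 -normr_eq0 -sqrf_eq0 hdot (dotDl dot) (dotNl dot).
  by rewrite eF eG subrr.
have [F [FU Foo]] := @ultraFilterLemma _ (\oo : set_system nat) _.
have [l Fl wl] := fixU F FU Foo.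
exists l => // y A Al.
apply: contrapT => nA.
(* If convergence against y failed for the neighbourhood [A], the tails restricted to the bad
   indices would form a proper filter. An ultrafilter refining it has the same weak limit l, so it
   contains good indices as well. *)
pose G0 := within (~` ((fun k => dot (x k) y) @^-1` A)) (\oo : set_system nat).
have G0P : ProperFilter G0.
  split; last exact: within_filter.
  move=> h; apply: nA; rewrite nbhs_filterE /fmap /=.
  by near=> k; apply: contrapT; near: k; exact: h.
have [G [GU G0G]] := ultraFilterLemma G0P.
have Goo : \oo `<=` G.
  by move=> X oX; apply: G0G; apply: filterS oX => k Xk _.
have [m Fm wm] := fixU G GU Goo.
have lm : l = m by exact: (uniqU F G).
have GA : G ((fun k => dot (x k) y) @^-1` A) by apply: wm; rewrite -lm.
have GnA : G (~` ((fun k => dot (x k) y) @^-1` A)).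
  by apply: G0G; exact: withinT.
by have [k []] := filter_ex (filterI GA GnA).
Unshelve. all: by end_near. Qed.

End WeakConvergence.

(** * Real sequences and separability *)

Section RealSequences.
Context (R : realType).
Implicit Types (Y s r l : nat -> R).

(** A pathwise substitute for the Robbins-Siegmund theorem: [Y - s] is nonincreasing and bounded
    below. The sequence [s] may oscillate, which is what admits the martingale of cross terms. *)
Lemma cvg_of_increment_le Y s : (forall k, 0 <= Y k) ->
  (forall k, Y k.+1 - Y k <= s k.+1 - s k) -> cvgn s -> cvgn Y.
Proof.
move=> Y0 Ys cs.
have cYs : cvgn (fun k => Y k - s k).
  apply: nonincreasing_is_cvgn.
    by apply/nonincreasing_seqP => k; have := Ys k; lra.
  have [M [_ hM]] := cvg_seq_bounded cs.
  exists (- (M + 1)) => _ [k _ <-].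
  have := hM (M + 1) (ltr_pwDr ltr01 (lexx M)) k I => /= /ler_normlP[h1 h2].
  by have := Y0 k; lra.
have -> : Y = (fun k => (Y k - s k) + s k) by apply/funext => k; rewrite subrK.
exact: is_cvgD.
Qed.

(* Since sum l_i = +oo, r is small infinitely often.  After the last time i <= k at
   which r_i < d one has l_m r_m <= l_m r_m^2 / d, so r cannot climb above 7 d. *)
Lemma residual_cvg0 l r :
  (forall k, 0 <= l k <= 1) -> (forall k, 0 <= r k) ->
  (forall N (B : R), exists k, B < \sum_(N <= i < k) l i) ->
  (forall e : R, 0 < e -> exists N, forall k, \sum_(N <= i < k) l i * r i ^+ 2 < e) ->
  (forall e : R, 0 < e -> exists N, forall j k, (N <= j)%N -> (j <= k)%N ->
     r k - r j <= 2 * (\sum_(j <= i < k) l i * r i) + e) ->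
  r k @[k --> \oo] --> 0.
Proof.
move=> l01 r0 ldiv lr2 osc.
have ge0 j k (F : nat -> R) : (forall i, 0 <= F i) -> 0 <= \sum_(j <= i < k) F i.
  by move=> F0; apply: sumr_ge0.
have lr0 i : 0 <= l i * r i ^+ 2.
  by rewrite mulr_ge0 ?sqr_ge0//; case/andP: (l01 i).
suff h (e : R) : 0 < e -> exists N, forall k, (N <= k)%N -> r k < e.
  apply/cvgrPdist_lt => e /h[N hN]; near=> k.
  rewrite sub0r normrN ger0_norm//; apply: hN.
  by near: k; exists N.
(* Budget in units of d: r_i < d at the last good time i, an oscillation error d, and twice a
   weighted sum of at most 2 d, where one d comes from the index i itself and one from d^-1 * d^2.
   The total stays below 6 d < e. *)
move=> e0; set d : R := e / 7; have d0 : 0 < d by rewrite /d; lra.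
have [N1 hN1] := lr2 _ (exprn_gt0 2 d0).
have [N2 hN2] := osc _ d0.
pose N := maxn N1 N2.
have [j Nj rj] : exists2 j, (N <= j)%N & r j < d.
  apply: contrapT => hj.
  have rN i : (N <= i)%N -> d <= r i.
    by move=> Ni; rewrite leNgt; apply/negP => ri; apply: hj; exists i.
  have [k hk] := ldiv N 1.
  have : \sum_(N <= i < k) d ^+ 2 * l i <= \sum_(N <= i < k) l i * r i ^+ 2.
    apply: ler_sum_nat => i /andP[Ni _].
    by rewrite mulrC ler_wpM2l//; [case/andP: (l01 i)|rewrite lerXn2r ?nnegrE ?(ltW d0) ?rN].
  rewrite -mulr_sumr.
  have [Nk|kN] := leqP N k; last first.
    by move: hk; rewrite big_geq ?(ltnW kN)// ltr10.
  have h1 : \sum_(N <= i < k) l i * r i ^+ 2 <= \sum_(N1 <= i < k) l i * r i ^+ 2.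
    by rewrite [leRHS](big_cat_nat _ (n := N)) ?leq_maxl//= lerDr ge0.
  have := hN1 k; nra.
exists j => k jk.
have [i [ji ik ri hi]] : exists i, [/\ (j <= i)%N, (i <= k)%N, r i < d &
    forall m, (i < m)%N -> (m <= k)%N -> d <= r m].
  elim: k jk => [|k IH].
    rewrite leqn0 => /eqP j0; move: rj; rewrite j0 => rj.
    by exists 0%N; split => //; case.
  rewrite leq_eqVlt => /predU1P[<-|].
    by exists j; split => // m jm mj; move: (leq_trans jm mj); rewrite ltnn.
  rewrite ltnS => /IH[i [ji ik ri hi]].
  have [rk|rk] := ltP (r k.+1) d.
    exists k.+1; split => //; first by rewrite (leq_trans ji)// (leq_trans ik).
    by move=> m h1 h2; move: (leq_trans h1 h2); rewrite ltnn.
  exists i; split => //; first exact: leq_trans ik _.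
  move=> m im; rewrite leq_eqVlt => /predU1P[->//|]; rewrite ltnS; exact: hi.
have := hN2 i k (leq_trans (leq_maxr _ _) (leq_trans Nj ji)) ik.
suff : \sum_(i <= m < k) l m * r m <= 2 * d by rewrite /d; move: ri; rewrite /d; lra.
move: ik; rewrite leq_eqVlt => /predU1P[<-|ik].
  by rewrite big_geq//; lra.
rewrite big_ltn//.
have h1 : l i * r i <= d.
  have /andP[l0 l1] := l01 i; have := r0 i; nra.
have h2 : \sum_(i.+1 <= m < k) l m * r m <= \sum_(i.+1 <= m < k) d^-1 * (l m * r m ^+ 2).
  apply: ler_sum_nat => m /andP[im mk].
  rewrite mulrCA ler_wpM2l//; first by case/andP: (l01 m).
  rewrite ler_pdivlMl// expr2 ler_wpM2r//.
  by apply: hi => //; exact: ltnW.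
have h3 : \sum_(i.+1 <= m < k) d^-1 * (l m * r m ^+ 2) <= d.
  rewrite -mulr_sumr ler_pdivrMl// -expr2 (le_trans _ (ltW (hN1 k)))//.
  rewrite [leRHS](big_cat_nat _ (n := i.+1))//= ?lerDr ?ge0//.
  by rewrite (leq_trans (leq_maxl N1 N2))// (leq_trans Nj)// (leq_trans ji).
lra.
Unshelve. all: by end_near. Qed.

End RealSequences.

Section SeparableNormed.
Context (R : realType) (H : normedModType R).

(** A dense subset of H may miss [A] entirely, so a point of [A] is selected in each ball around a
    dense point, of radius 1/(n+1), that meets [A]. *)
Lemma separable_subset (A : set H) : separable_space H ->
  exists B : set H, [/\ countable B, B `<=` A &
    forall p, A p -> forall e : R, 0 < e -> exists2 q, B q & `|p - q| < e].
Proof.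
move=> [S cS dS].
pose ok (sn : H * nat) q := A q /\ `|sn.1 - q| < sn.2.+1%:R^-1.
pose f sn := get (ok sn).
pose I := [set sn : H * nat | S sn.1 /\ exists q, ok sn q].
have okf sn : I sn -> ok sn (f sn) by move=> [_ [q hq]]; exact: (getI (x := q)).
exists (f @` I); split.
- apply: (sub_countable (card_image_le _ _)).
  apply: (@sub_countable _ _ _ (S `*` [set: nat])).
    by apply: subset_card_le => sn [? _]; split.
  by apply: countableX => //; exact: countableP.
- by move=> _ [sn /okf[] ? _ <-].
move=> p Ap e e0.
have [n hn] : exists n : nat, n.+1%:R^-1 < e / 2.
  have [n _ hn] := near_infty_natSinv_lt (PosNum (divr_gt0 e0 (ltr0n R 2))).
  by exists n; exact: hn (leqnn n).
have n0 : 0 < n.+1%:R^-1 :> R by rewrite invr_gt0.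
have [s [bs Ss]] : ball p n.+1%:R^-1 `&` S !=set0.
  by apply: dS; [exists p; exact: ballxx | exact: ball_open].
have Isn : I (s, n).
  by split => //; exists p; split => //=; rewrite distrC; move: bs; rewrite -ball_normE.
exists (f (s, n)); first by exists (s, n).
have [_ /= h] := okf _ Isn.
move: bs; rewrite -ball_normE /= => bs.
rewrite (le_lt_trans (ler_distD s _ _))//.
by move: hn h bs; move: (n.+1%:R^-1) => c; lra.
Qed.

(** The maps p |-> |x_k - p| are 1-Lipschitz uniformly in k, so limits pass from a dense set to its
    closure. This lets a single null set serve all fixed points. *)
Lemma cvg_dist_dense (x : nat -> H) (B : set H) (p : H) :
  (forall q, B q -> cvgn (fun k => `|x k - q|)) ->
  (forall e : R, 0 < e -> exists2 q, B q & `|p - q| < e) ->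
  cvgn (fun k => `|x k - p|).
Proof.
move=> Bcvg pB; apply/cauchy_cvgP/cauchy_exP => e e0.
have [q Bq pq] := pB (e / 4) (divr_gt0 e0 (ltr0n R 4)).
exists (lim (`|x k - q| @[k --> \oo])).
have e4 : 0 < e / 4 by lra.
have /cvgrPdist_lt/(_ _ e4) h := Bcvg _ Bq.
suff : \forall k \near \oo, `|lim (`|x j - q| @[j --> \oo]) - `|x k - p| | < e.
  by rewrite -ball_normE.
near=> k.
have : `|lim (`|x j - q| @[j --> \oo]) - `|x k - q| | < e / 4 by near: k.
have h1 := ler_distD p (x k) q.
have h2 := ler_distD q (x k) p.
rewrite (distrC q p) in h2.
by rewrite !ltr_norml => /andP[h3 h4]; apply/andP; split; lra.
Unshelve. all: by end_near. Qed.

End SeparableNormed.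

(** * Measurability in a separable Hilbert space *)

Lemma separable_seq (R : realType) (H : normedModType R) (A : set H) :
  separable_space H -> A !=set0 -> exists2 q : nat -> H, (forall n, A (q n)) &
    forall p, A p -> forall e : R, 0 < e -> exists n, `|p - q n| < e.
Proof.
move=> sepH [a0 Aa0].
have [B [/countable_injP[f fB] BA dB]] := separable_subset A sepH.
(* [f] injects [B] into the integers; indices outside its image receive the default [a0], which also
   lies in [A]. *)
exists (fun n => xget a0 [set b | B b /\ f b = n]) => [n|p Ap e e0].
  by case: xgetP => [b _ [/BA]|].
have [b Bb pb] := dB p Ap e e0.
exists (f b); case: xgetP => [c _ [Bc fc]|/(_ b)]; last by case.
by rewrite (fB _ _ _ _ fc) ?inE.
Qed.

(** The second hypothesis encodes that [g] is the pointwise infimum of the [h n]: its strict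
    sublevel sets are countable unions of theirs. *)
Lemma measurable_fun_of_lt (R : realType) d (X : measurableType d) (g : X -> R)
    (h : nat -> X -> R) :
  (forall n, measurable_fun setT (h n)) ->
  (forall w a, g w < a <-> exists n, h n w < a) ->
  measurable_fun setT g.
Proof.
move=> mh gh mT; apply: (measurability _ (RGenInftyO.measurableE R)) => //.
move=> _ [_ [a ->] <-]; rewrite setTI.
rewrite (_ : _ @^-1` _ = \bigcup_n (h n @^-1` `]-oo, a[)).
  by apply: bigcupT_measurable => n; rewrite -[X in measurable X]setTI; exact: mh.
apply/seteqP; split => w /=; rewrite in_itv/=.
  by move=> /gh[n hn]; exists n => //=; rewrite in_itv.
by move=> [n _ /=]; rewrite in_itv/= => hn; apply/gh; exists n.
Qed.

Section WeakMeasurability.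
Context (R : realType) (H : normedModType R) (dot : {dot H for @idfun R}).
Hypotheses (hdot : norm_of_dot dot) (hsep : separable_space H).

Let dense_seq : exists q : nat -> H, forall p (e : R), 0 < e ->
  exists n, `|p - q n| < e.
Proof.
have [|q _ dq] := separable_seq (A := setT) hsep; first by exists 0.
by exists q => p; exact: dq.
Qed.

(* On a separable space this is Borel measurability (Pettis). *)
Definition weakly_measurable d (X : measurableType d) (f : X -> H) : Prop :=
  forall y, measurable_fun setT (fun w => dot (f w) y).

Lemma borel_weakly_measurable d (X : measurableType d) (f : X -> H) :
  borel_measurable f -> weakly_measurable f.
Proof.
move=> mf y mT; apply: (measurability _ (RGenInftyO.measurableE R)) => //.
move=> _ [_ [a ->] <-].
have -> : (fun w => dot (f w) y) @^-1` `]-oo, a[ =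
    f @^-1` ((fun x => dot x y) @^-1` `]-oo, a[) by [].
apply: mf => //; apply: sub_sigma_algebra.
apply: (@open_comp _ _ (fun x => dot x y)); last exact: interval_open.
by move=> x _; exact: (dot_continuous hdot).
Qed.

Section Closure.
Context d (X : measurableType d).
Implicit Types (f g : X -> H) (a : X -> R).

Lemma weakly_measurable_cst (h : H) : weakly_measurable (fun _ : X => h).
Proof. by move=> y; exact: measurable_cst. Qed.

Lemma weakly_measurableD f g : weakly_measurable f -> weakly_measurable g ->
  weakly_measurable (fun w => f w + g w).
Proof.
move=> mf mg y; under eq_fun do rewrite (dotDl dot).
exact: measurable_funD.
Qed.

Lemma weakly_measurableZ a f : measurable_fun setT a -> weakly_measurable f ->
  weakly_measurable (fun w => a w *: f w).
Proof.
move=> ma mf y; under eq_fun do rewrite (dotZl dot).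
exact: measurable_funM.
Qed.

Lemma weakly_measurableB f g : weakly_measurable f -> weakly_measurable g ->
  weakly_measurable (fun w => f w - g w).
Proof.
move=> mf mg y; under eq_fun do rewrite (dotDl dot) (dotNl dot).
exact: measurable_funB.
Qed.

(* - |f|^2 is the infimum of |q|^2 - 2 <f, q> over a dense sequence of points q. *)
Lemma measurable_sqr_norm f : weakly_measurable f ->
  measurable_fun setT (fun w => `|f w| ^+ 2).
Proof.
move=> mf; have [q dq] := dense_seq.
rewrite (_ : (fun _ => _) = (fun w => - (- `|f w| ^+ 2))); last first.
  by apply/funext => w; rewrite opprK.
apply: measurableT_comp => //.
apply: (@measurable_fun_of_lt _ _ _ _ (fun n w => `|q n| ^+ 2 - 2 * dot (f w) (q n))).
  move=> n; apply: measurable_funB => //.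
  by apply: measurable_funM.
move=> w a; split => [h|[n hn]]; last first.
  by have := sqr_ge0 (`|f w - q n|); rewrite (sqr_normB hdot); lra.
have c0 : 0 < Num.sqrt (a + `|f w| ^+ 2) by rewrite sqrtr_gt0; lra.
have [n hn] := dq (f w) _ c0; exists n.
have : `|f w - q n| ^+ 2 < a + `|f w| ^+ 2.
  by rewrite -[ltRHS]sqr_sqrtr ?ltrXn2r ?nnegrE ?(ltW c0)//; lra.
by rewrite (sqr_normB hdot); lra.
Qed.

Lemma measurable_normr_weakly f : weakly_measurable f ->
  measurable_fun setT (fun w => `|f w|).
Proof.
move=> /measurable_sqr_norm mf.
rewrite (_ : (fun _ => _) = (fun w => Num.sqrt (`|f w| ^+ 2))); last first.
  by apply/funext => w; rewrite sqrtr_sqr normr_id.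
apply: (measurableT_comp _ mf); apply: continuous_measurable_fun.
exact: sqrt_continuous.
Qed.

Lemma measurable_dot f g : weakly_measurable f -> weakly_measurable g ->
  measurable_fun setT (fun w => dot (f w) (g w)).
Proof.
move=> mf mg.
rewrite (_ : (fun _ => _) = (fun w =>
    2^-1 * (`|f w + g w| ^+ 2 - `|f w| ^+ 2 - `|g w| ^+ 2))); last first.
  by apply/funext => w; rewrite (sqr_normD hdot); lra.
apply: measurable_funM => //.
by do 2 (apply: measurable_funB; last exact: measurable_sqr_norm);
  apply: measurable_sqr_norm; exact: weakly_measurableD.
Qed.

(* McShane: if g is L-Lipschitz then g x is the infimum of g q + L |x - q| over
   a dense sequence of points q. *)
Lemma measurable_lipschitz_comp (g : X -> H -> R) (L : R) f : 0 <= L ->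
  (forall w x y, g w x - g w y <= L * `|x - y|) ->
  (forall x, measurable_fun setT (g ^~ x)) ->
  weakly_measurable f -> measurable_fun setT (fun w => g w (f w)).
Proof.
move=> L0 gL mg mf; have [q dq] := dense_seq.
apply: (@measurable_fun_of_lt _ _ _ _ (fun n w => g w (q n) + L * `|f w - q n|)).
  move=> n; apply: measurable_funD => //; apply: measurable_funM => //.
  by apply: measurable_normr_weakly; apply: weakly_measurableB => //;
    exact: weakly_measurable_cst.
move=> w a; split => [h|[n hn]]; last first.
  by have := gL w (f w) (q n); lra.
have c0 : 0 < (a - g w (f w)) / (2 * L + 1).
  by rewrite divr_gt0//; lra.
have [n hn] := dq (f w) _ c0; exists n.
have h1 := gL w (q n) (f w); rewrite distrC in h1.
have : `|f w - q n| * (2 * L + 1) < a - g w (f w) by rewrite -ltr_pdivlMr//; lra.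
by have := normr_ge0 (f w - q n); nra.
Qed.

(** A Carathéodory argument: paired with y, the map x |-> <S e x, y> is |y|-Lipschitz, so
    measurability in e for each fixed x extends to a random point [f w]. *)
Lemma weakly_measurable_nonexpansive d' (E : measurableType d')
    (S : E -> H -> H) (u : X -> E) f :
  (forall e, nonexpansive (S e)) -> (forall x, weakly_measurable (S ^~ x)) ->
  measurable_fun setT u -> weakly_measurable f ->
  weakly_measurable (fun w => S (u w) (f w)).
Proof.
move=> Sne mS mu mf y.
apply: (@measurable_lipschitz_comp (fun w x => dot (S (u w) x) y) `|y|) => //.
- move=> w x z; rewrite -(dotNl dot) -(dotDl dot) mulrC.
  by rewrite (le_trans (cauchy_schwarz hdot _ _))// ler_wpM2r//; exact: Sne.
- by move=> x; exact: (measurableT_comp (mS x y) mu).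
Qed.

End Closure.

Lemma weakly_measurable_comp d d' (X : measurableType d) (Y : measurableType d')
    (f : Y -> H) (u : X -> Y) :
  weakly_measurable f -> measurable_fun setT u -> weakly_measurable (f \o u).
Proof. by move=> mf mu y; exact: (measurableT_comp (mf y) mu). Qed.

End WeakMeasurability.

(** * The Bochner integral *)

Section BochnerDot.
Context (R : realType) (H : completeNormedModType R).
Context (dot : {dot H for @idfun R}).
Hypotheses (hdot : norm_of_dot dot) (hsep : separable_space H).
Context d (E : measurableType d) (D : probability E R).

Lemma simple_preimage_measurable (s : E -> H) (v : H) :
  simple_function s -> measurable (s @^-1` [set v]).
Proof.
move=> [_ ms]; rewrite -[X in measurable X]setTI.
apply: (ms measurableT); rewrite -(setCK [set v]); apply: measurableC.
apply: sub_sigma_algebra; apply: closed_openC.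
exact: (@accessible_closed_set1 _ (hausdorff_accessible (@norm_hausdorff _ H))).
Qed.

Lemma simple_integral_dot (s : E -> H) (y : H) : simple_function s ->
  D.-integrable setT (EFin \o (fun e => dot (s e) y)) /\
  dot (simple_integral D s) y = \int[D]_e dot (s e) y.
Proof.
move=> ss; have [fs _] := ss.
have dE e : (dot (s e) y)%:E =
    (\sum_(v <- fset_set (range s)) (dot v y)%:E * (\1_(s @^-1` [set v]) e)%:E)%E.
  have sin : s e \in fset_set (range s).
    by rewrite in_fset_set// inE; exists e.
  rewrite (big_fsetD1 (s e))//= big_seq big1 ?adde0.
    by rewrite indicE mem_set// mule1.
  move=> v; rewrite in_fsetD1 => /andP[/eqP vs _].
  by rewrite indicE memNset ?mule0//= => vse; apply: vs.
have int1 v : D.-integrable setT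
    (fun e => (dot v y)%:E * (\1_(s @^-1` [set v]) e)%:E)%E.
  apply: integrableZl => //; apply: integrable_indic => //.
  exact: simple_preimage_measurable.
have dE' : EFin \o (fun e => dot (s e) y) = (fun e =>
   (\sum_(v <- fset_set (range s)) (dot v y)%:E * (\1_(s @^-1` [set v]) e)%:E)%E).
  by apply/funext => e; exact: dE.
split; first by rewrite dE'; exact: integrable_sum.
rewrite /Rintegral (eq_integral _ _ (fun e _ => dE e)) integral_sum//.
rewrite /simple_integral fsbig_finite//=.
rewrite (big_morph (fun x => dot x y) (id1 := 0) (op1 := +%R)); last 2 first.
  - by move=> a b; exact: (dotDl dot).
  - exact: (dot0l dot).
rewrite -sum_fine; last first.
  by move=> v _; exact: (integrable_fin_num _ (int1 v)).
apply: eq_bigr => v _; rewrite (dotZl dot) integralZl//; last first.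
  by apply: integrable_indic => //; exact: simple_preimage_measurable.
have mv : measurable (s @^-1` [set v]) by exact: simple_preimage_measurable.
by rewrite integral_indic// setIT fineM ?fin_num_measure// mulrC.
Qed.

(** The error bound is uniform over unit vectors y, with [del n] the integral of |f - s_n|;
    uniformity later makes the simple integrals Cauchy in norm. It holds only for large n because
    the first of these integrals may be infinite. *)
Lemma bochner_approx_dot (f : E -> H) (s : nat -> E -> H) :
  weakly_measurable dot f -> bochner_approx D f s ->
  (forall y, D.-integrable setT (EFin \o (fun e => dot (f e) y))) /\
  exists2 del : nat -> R, del @ \oo --> 0 & \forall n \near \oo, forall y,
    `|dot (simple_integral D (s n)) y - \int[D]_e dot (f e) y| <= del n * `|y|.
Proof.
move=> mf [ss _ scvg].
have ms n : weakly_measurable dot (s n).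
  by apply: (borel_weakly_measurable hdot); have [] := ss n.
have mB n : measurable_fun setT (fun e => `|f e - s n e|).
  by apply: (measurable_normr_weakly hdot hsep); exact: weakly_measurableB.
have /fine_cvgP[fin del0] :
  (fun n => (\int[D]_e `|f e - s n e|%:E)%E) @ \oo --> (0 : R)%:E := scvg.
have intB : \forall n \near \oo,
    D.-integrable setT (EFin \o (fun e => `|f e - s n e|)).
  near=> n; apply/integrableP; split; first exact/measurable_EFinP.
  under eq_integral do rewrite /= normr_id.
  have : (\int[D]_e `|f e - s n e|%:E \is a fin_num)%E by near: n.
  by rewrite ge0_fin_numE// integral_ge0.
have intBd n y : D.-integrable setT (EFin \o (fun e => `|f e - s n e|)) ->
    D.-integrable setT (EFin \o (fun e => dot (f e - s n e) y)).
  move=> iB; apply: (le_integrable _ _ _ (integrableZl _ `|y| iB)) => //.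
    by apply/measurable_EFinP; exact: weakly_measurableB.
  move=> e _ /=; rewrite lee_fin normrM !normr_id mulrC.
  exact: normr_dot.
have intf y : D.-integrable setT (EFin \o (fun e => dot (f e) y)).
  near \oo => n.
  have iB : D.-integrable setT (EFin \o (fun e => `|f e - s n e|)) by near: n.
  have := integrableD measurableT (intBd n y iB) (simple_integral_dot y (ss n)).1.
  apply: eq_integrable => // e _ /=.
  by rewrite -EFinD (dotDl dot) (dotNl dot) subrK.
split => //.
exists (fun n => \int[D]_e `|f e - s n e|); first exact: del0.
near=> n => y.
have iB : D.-integrable setT (EFin \o (fun e => `|f e - s n e|)) by near: n.
rewrite (simple_integral_dot y (ss n)).2 distrC -RintegralB//; last first.
  exact: (simple_integral_dot y (ss n)).1.
under eq_Rintegral do rewrite -(dotNl dot) -(dotDl dot).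
apply: (le_trans (le_normr_Rintegral _ _)) => //; first exact: intBd.
rewrite -RintegralZr//; apply: le_Rintegral => //.
- exact/integrable_norm/intBd.
- have := integrableZl measurableT `|y| iB.
  by apply: eq_integrable => // e _ /=; rewrite mulrC.
- by move=> e _; exact: normr_dot.
Unshelve. all: by end_near. Qed.

(** The integral is a chosen limit, so two approximating sequences occur: [s] shows by completeness
    that some limit exists, and the identity is passed to the limit along the sequence [s'] that
    belongs to the chosen value. *)
Lemma bochner_integral_dot (f : E -> H) (y : H) :
  weakly_measurable dot f -> bochner_integrable D f ->
  D.-integrable setT (EFin \o (fun e => dot (f e) y)) /\
  dot (bochner_integral D f) y = \int[D]_e dot (f e) y.
Proof.
move=> mf [s fs]; have [intf [del del0 hdel]] := bochner_approx_dot mf fs.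
split => //.
pose J n := simple_integral D (s n).
have Jcvg : cvgn J.
  apply/cauchy_cvgP/cauchy_exP => e e0.
  have e3 : 0 < e / 3 by lra.
  have hd : \forall n \near \oo, (forall y,
      `|dot (J n) y - \int[D]_e dot (f e) y| <= del n * `|y|) /\ del n < e / 3.
    apply: filterI => //.
    have /cvgrPdist_lt/(_ _ e3) := del0.
    by apply: filterS => n; rewrite sub0r normrN; apply: le_lt_trans; exact: ler_norm.
  have [N _ hN] := hd; exists (J N).
  exists N => // n /= Nn; rewrite -ball_normE /=.
  have [h1 d1] := hN N (leqnn N); have [h2 d2] := hN n Nn.
  (* Testing the uniform estimate against z itself turns the bound on inner products into a bound on
     |z|. *)
  set z := J N - J n.
  have zz : `|z| ^+ 2 <= (2 * (e / 3)) * `|z|.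
    rewrite hdot {1}/z (dotDl dot) (dotNl dot).
    have := h1 z; have := h2 z.
    rewrite !ler_norml => /andP[h3 h4] /andP[h5 h6].
    by have := normr_ge0 z; nra.
  have [z0|z0] := eqVneq `|z| 0; first by rewrite z0.
  have zp : 0 < `|z| by rewrite lt_neqAle eq_sym z0 normr_ge0.
  by move: zz; rewrite expr2 ler_pM2r//; lra.
have [s' fs' Js'] : [set v | exists2 s, bochner_approx D f s &
    (fun n => simple_integral D (s n)) @ \oo --> v] (bochner_integral D f).
  by apply: (xgetPex 0); exists (lim (J @ \oo)), s.
have [_ [del' del'0 hdel']] := bochner_approx_dot mf fs'.
have c1 : dot (simple_integral D (s' n)) y @[n --> \oo] -->
    dot (bochner_integral D f) y.
  exact: (cvg_comp _ _ Js' (@dot_continuous _ _ _ hdot y _)).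
apply: (cvg_unique _ c1) => //.
have c2 : del' n * `|y| @[n --> \oo] --> 0.
  by rewrite -[X in _ --> X](mul0r `|y|); apply: cvgM => //; exact: cvg_cst.
apply/cvgrPdist_le => e e0; near=> n.
rewrite distrC (@le_trans _ _ (del' n * `|y|))//.
  by near: n; apply: filterS hdel' => n; exact.
have : `|0 - del' n * `|y| | <= e by near: n; move/cvgrPdist_le : c2; exact.
by rewrite sub0r normrN; apply: le_trans; exact: ler_norm.
Unshelve. all: by end_near. Qed.

End BochnerDot.

(** * One step of the iteration *)

Lemma EFin_Rintegral (R : realType) d (E : measurableType d)
    (mu : {measure set E -> \bar R}) (f : E -> R) :
  mu.-integrable setT (EFin \o f) ->
  (\int[mu]_e f e)%:E = (\int[mu]_e (f e)%:E)%E.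
Proof. by move=> intf; rewrite /Rintegral fineK//; exact: integrable_fin_num. Qed.

Lemma integrable_le_norm (R : realType) d (E : measurableType d)
    (mu : {measure set E -> \bar R}) (f g : E -> R) :
  measurable_fun setT f -> (forall e, `|f e| <= g e) ->
  mu.-integrable setT (EFin \o g) -> mu.-integrable setT (EFin \o f).
Proof.
move=> mf fg ig; apply: (le_integrable _ _ _ ig) => //.
  exact/measurable_EFinP.
by move=> e _ /=; rewrite lee_fin (le_trans (fg e))// ler_norm.
Qed.

Section MeanOperator.
Context (R : realType) (H : normedModType R) (dot : {dot H for @idfun R}).
Hypotheses (hdot : norm_of_dot dot) (hsep : separable_space H).
Context d (E : measurableType d) (D : probability E R).

Let integrableD_cst (r : R) : D.-integrable setT (EFin \o (fun=> r)).
Proof. exact: finite_measure_integrable_cst. Qed.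

Let IntD (f g : E -> R) : D.-integrable setT (EFin \o f) ->
  D.-integrable setT (EFin \o g) ->
  D.-integrable setT (EFin \o (fun e => f e + g e)).
Proof.
by move=> h k; apply: eq_integrable (integrableD _ h k) => // e _ /=.
Qed.

Let IntZ (r : R) (f : E -> R) : D.-integrable setT (EFin \o f) ->
  D.-integrable setT (EFin \o (fun e => r * f e)).
Proof. by move=> h; apply: eq_integrable (integrableZl _ r h) => // e _ /=. Qed.

Definition centered (V : E -> H) : Prop := forall y,
  D.-integrable setT (EFin \o (fun e => dot (V e) y)) /\
  \int[D]_e dot (V e) y = 0.

(** Pythagoras: the cross term 2 l <V, h> integrates to 0. In the application h is a past increment
    of the noise martingale and V the fresh noise. *)
Lemma centered_sqr (V : E -> H) (h : H) (l : R) :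
  weakly_measurable dot V -> centered V ->
  D.-integrable setT (EFin \o (fun e => `|V e| ^+ 2)) ->
  (\int[D]_e (`|h + l *: V e| ^+ 2)%:E)%E =
  (`|h| ^+ 2 + l ^+ 2 * \int[D]_e `|V e| ^+ 2)%:E.
Proof.
move=> mV cV iV; have [iVh Vh0] := cV h.
have eqV e : `|h + l *: V e| ^+ 2 =
    `|h| ^+ 2 + (2 * l * dot (V e) h + l ^+ 2 * `|V e| ^+ 2).
  rewrite (sqr_normD hdot) (dotZr dot) (dotC dot h) normrZ exprMn.
  by rewrite real_normK ?num_real//; ring.
under eq_integral do rewrite eqV.
have i1 := IntZ (2 * l) iVh; have i2 := IntZ (l ^+ 2) iV.
rewrite -EFin_Rintegral; last exact/IntD/IntD.
rewrite RintegralD//; last exact: IntD.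
rewrite RintegralD// !RintegralZl// Vh0 Rintegral_cst//= probability_setT/=.
by rewrite !mulr1 mulr0 add0r.
Qed.

(** The scalar counterpart: the lower bound becomes the submartingale property, the upper bound the
    growth of the second moment, with the variance of <V, z> estimated by Cauchy-Schwarz. *)
Lemma centered_dot_sqr (V : E -> H) (z : H) (h l : R) :
  weakly_measurable dot V -> centered V ->
  D.-integrable setT (EFin \o (fun e => `|V e| ^+ 2)) ->
  ((h ^+ 2)%:E <= \int[D]_e ((h + l * dot (V e) z) ^+ 2)%:E
    <= (h ^+ 2 + l ^+ 2 * (`|z| ^+ 2 * \int[D]_e `|V e| ^+ 2))%:E)%E.
Proof.
move=> mV cV iV; have [iVz Vz0] := cV z.
have vz e : dot (V e) z ^+ 2 <= `|z| ^+ 2 * `|V e| ^+ 2.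
  rewrite -(real_normK (num_real (dot (V e) z))) mulrC -exprMn.
  by rewrite lerXn2r ?nnegrE ?mulr_ge0//; exact: normr_dot.
have iz := IntZ (`|z| ^+ 2) iV.
have iv2 : D.-integrable setT (EFin \o (fun e => dot (V e) z ^+ 2)).
  apply: (integrable_le_norm _ _ iz); first exact: measurable_funX (mV z).
  by move=> e; rewrite ger0_norm ?sqr_ge0.
have eqV e : (h + l * dot (V e) z) ^+ 2 =
    h ^+ 2 + (2 * h * l * dot (V e) z + l ^+ 2 * dot (V e) z ^+ 2) by ring.
under eq_integral do rewrite eqV.
have i1 := IntZ (2 * h * l) iVz; have i2 := IntZ (l ^+ 2) iv2.
have i12 := IntD i1 i2.
rewrite -EFin_Rintegral; last exact: IntD.
rewrite RintegralD// RintegralD// Rintegral_cst// !RintegralZl// Vz0.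
rewrite /= probability_setT /= mulr1 mulr0 add0r !lee_fin lerDl lerD2l.
rewrite mulr_ge0 ?sqr_ge0 ?Rintegral_ge0//=; last by move=> e _; exact: sqr_ge0.
by rewrite ler_wpM2l ?sqr_ge0// -RintegralZl//; exact: le_Rintegral.
Qed.

Context (S : E -> H -> H) (T : H -> H).
Hypotheses (Sne : forall e, nonexpansive (S e))
  (mS : forall x, weakly_measurable dot (S ^~ x)).
Hypothesis ST : forall x y,
  D.-integrable setT (EFin \o (fun e => dot (S e x) y)) /\
  dot (T x) y = \int[D]_e dot (S e x) y.

Lemma centered_mean_operator x : centered (fun e => S e x - T x).
Proof.
move=> y; have [i1 e1] := ST x y.
have eqS e : dot (S e x - T x) y = dot (S e x) y + - dot (T x) y.
  by rewrite (dotDl dot) (dotNl dot).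
split.
  have -> : (fun e => dot (S e x - T x) y) = fun e => dot (S e x) y + - dot (T x) y.
    exact/funext.
  exact: IntD.
under eq_Rintegral do rewrite eqS.
by rewrite RintegralD// Rintegral_cst//= probability_setT/= mulr1 e1 subrr.
Qed.

(** Testing the mean against z = T x - T y gives |z|^2 <= |x - y| |z|. *)
Lemma mean_operator_nonexpansive : nonexpansive T.
Proof.
move=> x y; set z := T x - T y.
have [-> //|z0] := eqVneq `|z| 0.
have zp : 0 < `|z| by rewrite lt_neqAle eq_sym z0 normr_ge0.
have [ix ex] := ST x z; have [iy ey] := ST y z.
rewrite -(ler_pM2r zp) -expr2 hdot {1}/z (dotDl dot) (dotNl dot) ex ey.
rewrite -RintegralB//.
rewrite -[leRHS]mulr1 -[X in _ * X](_ : fine (D setT) = 1); last first.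
  by rewrite probability_setT.
rewrite -Rintegral_cst//; apply: le_Rintegral => //.
  have := IntD ix (IntZ (-1) iy).
  by apply: eq_integrable => // e _ /=; rewrite mulN1r.
move=> e _; rewrite -(dotNl dot) -(dotDl dot).
by rewrite (le_trans (cauchy_schwarz hdot _ _))// ler_wpM2r//; exact: Sne.
Qed.

Variable p : H.
Hypothesis Tp : T p = p.
Hypothesis iVp : D.-integrable setT (EFin \o (fun e => `|S e p - p| ^+ 2)).

Let sigma2 := \int[D]_e `|S e p - p| ^+ 2.

Let centeredp : centered (fun e => S e p - p).
Proof. by rewrite -{2}Tp; exact: centered_mean_operator. Qed.

Let measurable_sqr x z : measurable_fun setT (fun e => `|S e x - z| ^+ 2).
Proof.
apply: (measurable_sqr_norm hdot hsep).
by apply: weakly_measurableB => //; exact: weakly_measurable_cst.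
Qed.

(** The three differences below have norms at most |y - p|, |y - p| and |S e p - p|; the constants
    come from (2 u + v)^2 <= 8 u^2 + 2 v^2. *)
Let noise_le e y : `|S e y - T y| ^+ 2 <= 8 * `|y - p| ^+ 2 + 2 * `|S e p - p| ^+ 2.
Proof.
have -> : S e y - T y = (S e y - S e p) + (p - T y) + (S e p - p).
  by dot_ring hdot.
have h1 := Sne e y p; have h2 : `|p - T y| <= `|y - p|.
  by rewrite -{1}Tp distrC; exact: mean_operator_nonexpansive.
have := ler_normD ((S e y - S e p) + (p - T y)) (S e p - p).
have := ler_normD (S e y - S e p) (p - T y).
move: h1 h2.
move: (normr_ge0 (S e y - S e p + (p - T y) + (S e p - p))).
move: `|S e y - S e p + (p - T y) + (S e p - p)| `|S e y - S e p + (p - T y)|.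
move: (normr_ge0 (y - p)) (normr_ge0 (S e p - p)).
move: `|S e y - S e p| `|p - T y| `|y - p| `|S e p - p| => a b c f c0 f0 u v u0 h1 h2 h3 h4.
have : u <= 2 * c + f by lra.
move=> h; have : u ^+ 2 <= (2 * c + f) ^+ 2 by rewrite lerXn2r ?nnegrE//; lra.
by have := sqr_ge0 (2 * c - f); lra.
Qed.

Lemma integrable_noise y :
  D.-integrable setT (EFin \o (fun e => `|S e y - T y| ^+ 2)).
Proof.
apply: (integrable_le_norm _ _ (IntD (integrableD_cst (8 * `|y - p| ^+ 2)) (IntZ 2 iVp))).
  exact: measurable_sqr.
by move=> e; rewrite ger0_norm ?sqr_ge0.
Qed.

Lemma noise_second_moment y :
  \int[D]_e `|S e y - T y| ^+ 2 <= 8 * `|y - p| ^+ 2 + 2 * sigma2.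
Proof.
rewrite -[8 * _]mulr1 -[X in _ * X + _](_ : fine (D setT) = 1); last first.
  by rewrite probability_setT.
rewrite -Rintegral_cst// -RintegralZl// -RintegralD//; last exact: IntZ.
by apply: le_Rintegral => //; [exact: integrable_noise|exact/IntD/IntZ].
Qed.

(** Nonexpansiveness turns 2 l <y - p, W> into a gain of l |W|^2. The term l^2 |U|^2 consumes the
    fraction (1 + k) / 2 of this gain, which leaves (1 - k) / 2. *)
Lemma km_step_pointwise (k l : R) e y : 0 < k -> k < 1 -> 0 < l -> l <= k ->
  `|y + l *: (S e y - y) - p| ^+ 2 <= `|y - p| ^+ 2
    + 2 * l * dot (S e p - p) (y - p)
    - (1 - k) / 2 * l * `|(S e y - y) - (S e p - p)| ^+ 2
    + (1 + k) / (1 - k) * l ^+ 2 * `|S e p - p| ^+ 2.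
Proof.
move=> k0 k1 l0 lk.
set U := S e y - y; set V := S e p - p; set W := U - V.
have UWV : U = W + V by rewrite subrK.
have hW : 2 * dot (y - p) W + `|W| ^+ 2 <= 0.
  have : `|(y - p) + W| ^+ 2 <= `|y - p| ^+ 2.
    rewrite (_ : y - p + W = S e y - S e p) ?lerXn2r ?nnegrE ?Sne//.
    by rewrite /W /U /V; dot_ring hdot.
  by rewrite (sqr_normD hdot); lra.
have -> : y + l *: U - p = (y - p) + l *: U by rewrite addrAC.
rewrite (sqr_normD hdot) (dotZr dot) normrZ exprMn real_normK ?num_real//.
rewrite {1}UWV (dotDr dot) (dotC dot V).
(* Young's inequality with the weight tau for which k (1 + tau) = (1 + k) / 2. *)
pose tau := (1 - k) / (2 * k).
have tau0 : 0 < tau by rewrite divr_gt0//; lra.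
have hU : `|U| ^+ 2 <= (1 + k) / (2 * k) * `|W| ^+ 2 + (1 + k) / (1 - k) * `|V| ^+ 2.
  have -> : (1 + k) / (2 * k) = 1 + tau by rewrite /tau; field; lra.
  have -> : (1 + k) / (1 - k) = 1 + tau^-1 by rewrite /tau; field; lra.
  rewrite UWV (sqr_normD hdot).
  have := sqr_ge0 (`|tau *: W - V|).
  rewrite (sqr_normB hdot) (dotZl dot) normrZ exprMn real_normK ?num_real// => h.
  have : 0 <= tau^-1 * (tau ^+ 2 * `|W| ^+ 2 - 2 * (tau * dot W V) + `|V| ^+ 2).
    by rewrite mulr_ge0// invr_ge0 ltW.
  have -> : tau^-1 * (tau ^+ 2 * `|W| ^+ 2 - 2 * (tau * dot W V) + `|V| ^+ 2) =
    tau * `|W| ^+ 2 - 2 * dot W V + tau^-1 * `|V| ^+ 2 by field; lra.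
  by lra.
have hlU : l ^+ 2 * `|U| ^+ 2 <=
    l * ((1 + k) / 2) * `|W| ^+ 2 + (1 + k) / (1 - k) * l ^+ 2 * `|V| ^+ 2.
  have := ler_wpM2l (sqr_ge0 l) hU; rewrite mulrDr => /le_trans; apply.
  rewrite [X in _ + X]mulrA [l ^+ 2 * (_ / (1 - k))]mulrC lerD2r [leLHS]mulrA.
  apply: ler_wpM2r; first exact: sqr_ge0.
  have -> : l ^+ 2 * ((1 + k) / (2 * k)) = l * ((1 + k) / 2) * (l / k) by field; lra.
  rewrite -[leRHS]mulr1; apply: ler_wpM2l; first by rewrite mulr_ge0//; lra.
  by rewrite ler_pdivrMr// mul1r.
have : l * (2 * dot (y - p) W + `|W| ^+ 2) <= 0 by rewrite pmulr_rle0.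
move: hlU.
move: ((1 + k) / (1 - k) * l ^+ 2 * `|V| ^+ 2) => c.
by nra.
Qed.

Lemma km_step_mean (k l : R) y : 0 < k -> k < 1 -> 0 < l -> l <= k ->
  (\int[D]_e (`|y + l *: (S e y - y) - p| ^+ 2)%:E
    + ((1 - k) / 2 * l * `|T y - y| ^+ 2)%:E
  <= (`|y - p| ^+ 2 + (1 + k) / (1 - k) * l ^+ 2 * sigma2)%:E)%E.
Proof.
move=> k0 k1 l0 lk.
set c := (1 - k) / 2; set C := (1 + k) / (1 - k).
set m := T y - y.
have c0 : 0 < c by rewrite /c; lra.
have [i1 e1] := ST y m.
have [i2 e2] := centeredp (y - p).
have [i3 e3] := centeredp m.
(* Jensen's inequality for W = (S e y - y) - (S e p - p), whose mean is m, in the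
   linearised form |W|^2 >= 2 <W, m> - |m|^2. *)
pose g e := (`|y - p| ^+ 2 + c * l * (`|m| ^+ 2 + 2 * dot y m)) +
   (2 * l * dot (S e p - p) (y - p) + ((- (2 * c * l)) * dot (S e y) m +
    (2 * c * l * dot (S e p - p) m + C * l ^+ 2 * `|S e p - p| ^+ 2))).
have fg e : `|y + l *: (S e y - y) - p| ^+ 2 <= g e.
  apply: le_trans (km_step_pointwise e y k0 k1 l0 lk) _.
  rewrite -/c -/C /g.
  set W := _ - (S e p - p).
  have : 0 <= c * l * `|W - m| ^+ 2 by rewrite mulr_ge0 ?sqr_ge0// mulr_ge0 ?ltW.
  have -> : `|W - m| ^+ 2 = `|W| ^+ 2 + `|m| ^+ 2
      - 2 * (dot (S e y) m - dot y m - dot (S e p - p) m).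
    by rewrite (sqr_normB hdot) !(dotE dot); ring.
  by lra.
have j1 := IntZ (2 * l) i2; have j2 := IntZ (- (2 * c * l)) i1.
have j34 := IntD (IntZ (2 * c * l) i3) (IntZ (C * l ^+ 2) iVp).
have j24 := IntD j2 j34; have j14 := IntD j1 j24.
have ig : D.-integrable setT (EFin \o g) by exact: IntD.
have if_ : D.-integrable setT (EFin \o (fun e => `|y + l *: (S e y - y) - p| ^+ 2)).
  apply: (integrable_le_norm _ _ ig) => //.
    apply: (measurable_sqr_norm hdot hsep).
    apply: weakly_measurableB; last exact: weakly_measurable_cst.
    apply: weakly_measurableD; first exact: weakly_measurable_cst.
    by apply: weakly_measurableZ => //; exact: weakly_measurableB.
  by move=> e; rewrite ger0_norm ?sqr_ge0.
rewrite -EFin_Rintegral// -EFinD lee_fin.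
have le1 : \int[D]_e `|y + l *: (S e y - y) - p| ^+ 2 <= \int[D]_e g e.
  exact: le_Rintegral.
have -> : `|y - p| ^+ 2 + C * l ^+ 2 * sigma2 = \int[D]_e g e + c * l * `|m| ^+ 2.
  rewrite /g !RintegralD//; try exact: IntZ.
  rewrite Rintegral_cst// !RintegralZl// !Rintegral_cst//= probability_setT/= e2 e3 -e1.
  have : dot (T y) m = dot y m + `|m| ^+ 2.
    by rewrite hdot /m !(dotE dot) (dotC dot y); ring.
  by rewrite /sigma2 => ->; ring.
by rewrite lerD2r.
Qed.

End MeanOperator.

(** * Independence of the past *)

Section Past.
Context (R : realType) (dO dE : measure_display).
Context (Omega : measurableType dO) (E : measurableType dE).
Context (P : probability Omega R) (xi : nat -> {RV P >-> E}).

(* A pi-system generating the sigma-algebra of xi_0, ..., xi_(k-1). *)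
Definition past k : set (set Omega) :=
  [set A | exists2 B : nat -> set E, (forall i, measurable (B i)) &
     A = \bigcap_(i in `I_k) (xi i @^-1` B i)].

(** The identity map, with a codomain carrying the coarser sigma-algebra of the past, so that the
    past becomes a random variable independent of xi_k. *)
Definition to_past k (w : Omega) : g_sigma_algebraType (past k) := w.

Lemma past_sub k : past k `<=` measurable.
Proof.
move=> _ [B mB ->]; apply: fin_bigcap_measurable => // i _.
exact: measurable_funPTI.
Qed.

Lemma past_setI_closed k : setI_closed (past k).
Proof.
move=> _ _ [B mB ->] [C mC ->]; exists (fun i => B i `&` C i).
  by move=> i; exact: measurableI.
by rewrite -bigcapI; apply: eq_bigcapr => i _; rewrite preimage_setI.
Qed.

Lemma past_setT k : past k setT.
Proof.
exists (fun=> setT) => //; apply/esym; rewrite -subTset => w _ i _ //.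
Qed.

Lemma past_le j k : (j <= k)%N -> past j `<=` past k.
Proof.
move=> jk _ [B mB ->].
exists (fun i => if (i < j)%N then B i else setT).
  by move=> i; case: ifP.
apply/seteqP; split=> w h i /= ik.
  by case: ifP => // ij; exact: h.
by have := h i (leq_trans ik jk); rewrite /= ik.
Qed.

Lemma measurable_past_le j k (A : set Omega) : (j <= k)%N ->
  <<s past j >> A -> <<s past k >> A.
Proof. by move=> jk; apply: sub_sigma_algebra2; exact: past_le. Qed.

Lemma past_measurable k (A : set Omega) : <<s past k >> A -> measurable A.
Proof.
apply: smallest_sub; [exact: sigma_algebra_measurable|exact: past_sub].
Qed.

Lemma measurable_to_past k : measurable_fun setT (to_past k).
Proof. by move=> _ A mA; rewrite setTI; exact: past_measurable mA. Qed.

HB.instance Definition _ k := isMeasurableFun.Build _ _ _ _ (to_past k)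
  (@measurable_to_past k).

Lemma measurable_fun_past_le dX (X : measurableType dX) j k (f : Omega -> X) :
  (j <= k)%N ->
  measurable_fun setT (f : g_sigma_algebraType (past j) -> X) ->
  measurable_fun setT (f : g_sigma_algebraType (past k) -> X).
Proof.
move=> jk mf _ A mA; have := mf measurableT A mA; rewrite !setTI.
exact: measurable_past_le.
Qed.

Lemma measurable_fun_past dX (X : measurableType dX) k (f : Omega -> X) :
  measurable_fun setT (f : g_sigma_algebraType (past k) -> X) ->
  measurable_fun setT f.
Proof. by move=> mf; exact: (measurableT_comp mf (@measurable_to_past k)). Qed.

Lemma measurable_xi_past j k : (j < k)%N ->
  measurable_fun setT (xi j : g_sigma_algebraType (past k) -> E).
Proof.
move=> jk _ A mA; rewrite setTI; apply: sub_sigma_algebra.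
exists (fun i => if i == j then A else setT) => [i|]; first by case: ifP.
apply/seteqP; split=> w h.
  by move=> i _ /=; case: eqP => // ->.
by have := h j jk; rewrite /= eqxx.
Qed.

Context (D : probability E R).
Hypothesis hlaw : forall k (A : set E), measurable A ->
  distribution P (xi k) A = D A.
Hypothesis hindep : mutually_independent xi.

Local Open Scope ereal_scope.

(** Two finite measures, P restricted to the event that xi_k lies in [B] and D(B) P, agree on the
    pi-system [past k], hence on the sigma-algebra it generates. *)
Lemma past_independent k (A : set Omega) (B : set E) :
  <<s past k >> A -> measurable B -> P (A `&` xi k @^-1` B) = P A * D B.
Proof.
move=> sA mB.
have mX : measurable (xi k @^-1` B) by exact: measurable_funPTI.
have DB0 : (0 <= fine (D B))%R by rewrite fine_ge0.
have eqm : mrestr P mX A = mscale (NngNum DB0) P A.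
  apply: (g_sigma_algebra_measure_unique (past k) (@past_sub k) (fun=> setT)) sA => //.
  - by move=> _; exact: past_setT.
  - by rewrite bigcup_const//; exists 0%N.
  - exact: past_setI_closed.
  - move=> _ [C mC ->]; rewrite /= /mrestr /mscale/= fineK ?fin_num_measure//.
    (* A single family for both uses of independence, on the indices below k and on the same indices
       with k added; the products differ exactly by the factor of [B]. *)
    pose C' i := if i == k then B else C i.
    have mC' i : measurable (C' i) by rewrite /C'; case: ifP.
    have C'E (J : {fset nat}) : (forall i, i \in J -> (i < k)%N) ->
        \bigcap_(i in [set` J]) (xi i @^-1` C' i) = \bigcap_(i in [set` J]) (xi i @^-1` C i).
      move=> Jk; apply: eq_bigcapr => i /= /Jk ik.
      by rewrite /C' ltn_eqF.
    pose J := [fset i in iota 0 k]%fset.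
    have JE : [set` J] = `I_k.
      by apply/seteqP; split=> i /=; rewrite in_fset /= mem_iota add0n.
    have Jk i : i \in J -> (i < k)%N by rewrite in_fset /= mem_iota add0n.
    have kJ : k \notin J by apply/negP => /Jk; rewrite ltnn.
    have := hindep (k |` J)%fset mC'.
    have C'k : C' k = B by rewrite /C' eqxx.
    rewrite big_fsetU1//= C'k.
    have -> : [set` (k |` J)%fset] = k |` [set` J].
      by apply/seteqP; split=> i /=; rewrite in_fset1U => /predU1P.
    rewrite bigcap_setU1 C'k C'E// JE setIC => ->.
    have := hindep J mC'; rewrite C'E// JE => <-.
    have := hlaw k mB; rewrite /distribution/= /pushforward => ->.
    by [].
  - by move=> i; rewrite /= /mrestr setTI -ge0_fin_numE ?fin_num_measure.
by move: eqm; rewrite /= /mrestr /mscale/= fineK ?fin_num_measure// muleC.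
Qed.

(** The joint law of the past and xi_k is a product measure; the inner integral on the right plays
    the role of the conditional expectation given the past. *)
Lemma integral_past_tonelli k (q : g_sigma_algebraType (past k) * E -> \bar R) :
  measurable_fun setT q -> (forall z, 0 <= q z) ->
  \int[P]_w q (w, xi k w) = \int[P]_w \int[D]_e q (w, e).
Proof.
move=> mq q0.
pose phi (w : Omega) : g_sigma_algebraType (past k) * E := (to_past k w, xi k w).
have mphi : measurable_fun setT phi by exact: measurable_fun_pair.
have <- : \int[pushforward P phi]_z q z = \int[P]_w q (w, xi k w).
  by rewrite (ge0_integral_pushforward mphi)// => z _; exact: q0.
transitivity (\int[distribution P (to_past k) \x D]_z q z).
  apply: eq_measure_integral => A mA _; apply/esym.
  apply: (@product_measure_unique _ _ _ _ _ (distribution P (to_past k)) D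
    (pushforward P phi)) => // B C mB mC.
  rewrite /pushforward /= -(past_independent mB mC); congr (P _).
rewrite fubini_tonelli1//.
rewrite (ge0_integral_pushforward (@measurable_to_past k))//.
- exact: measurable_fun_fubini_tonelli_F.
- by move=> z _; apply: integral_ge0.
Qed.

End Past.

(** * The maximal inequality *)

Section MaximalInequality.
Context (R : realType) (d : measure_display).
Context (Omega : measurableType d) (P : probability Omega R).
Context (F : nat -> set (set Omega)).
Hypotheses (sF : forall k, sigma_algebra setT (F k))
  (mF : forall k, F k `<=` measurable)
  (ndF : forall k, F k `<=` F k.+1).
Context (m : nat) (Q : nat -> Omega -> R).
Hypotheses (Q0 : forall k w, 0 <= Q k w)
  (adaptedQ : forall k c, (m <= k)%N -> F k [set w | c <= Q k w])
  (mQ : forall k, (m <= k)%N -> measurable_fun setT (Q k))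
  (subQ : forall k A, (m <= k)%N -> F k A ->
    (\int[P]_(w in A) (Q k w)%:E <= \int[P]_(w in A) (Q k.+1 w)%:E)%E).

Let exceed c k := [set w | exists2 j, (m <= j <= k)%N & c <= Q j w].

Let exceedS c k : (m <= k)%N ->
  exceed c k.+1 = exceed c k `|` ([set w | c <= Q k.+1 w] `\` exceed c k).
Proof.
move=> mk; rewrite setDE setUIr setUv setIT.
apply/seteqP; split=> w.
  move=> [j /andP[mj]]; rewrite leq_eqVlt => /predU1P[->|]; first by right.
  by rewrite ltnS => jk Qj; left; exists j => //; rewrite mj.
move=> [[j /andP[mj jk] Qj]|h].
  by exists j => //; rewrite mj/= (leq_trans jk).
by exists k.+1 => //; rewrite leqnn (leq_trans mk).
Qed.

Let exceed_m c : exceed c m = [set w | c <= Q m w].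
Proof.
apply/seteqP; split=> w; last by exists m => //; rewrite leqnn.
by move=> [j]; rewrite -eqn_leq => /eqP<-.
Qed.

Let FU k A B : F k A -> F k B -> F k (A `|` B).
Proof.
have [F0 FC Fb] := sF k.
move=> FA FB; rewrite -bigcup2E; apply: Fb.
by case=> [|[|]].
Qed.

Let F_exceed c k : (m <= k)%N -> F k (exceed c k).
Proof.
elim: k => [|k IH].
  by rewrite leqn0 => /eqP m0; rewrite -m0 exceed_m; exact: adaptedQ.
rewrite leq_eqVlt => /predU1P[<-|]; first by rewrite exceed_m; exact: adaptedQ.
rewrite ltnS => mk; rewrite exceedS// setDE setUIr setUv setIT; apply: FU.
  exact/ndF/IH.
by apply: adaptedQ; exact: leq_trans mk _.
Qed.

Let measurable_exceed c k : (m <= k)%N -> measurable (exceed c k).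
Proof. by move=> mk; apply: mF; exact: F_exceed. Qed.

(* By induction on k: the part of the event already realised at time k is handled
   by the submartingale property, the new part by Q (k+1) >= c. *)
Let exceed_le c k : 0 <= c -> (m <= k)%N ->
  (c%:E * P (exceed c k) <= \int[P]_(w in exceed c k) (Q k w)%:E)%E.
Proof.
move=> c0.
have base A k' : (m <= k')%N -> measurable A -> A `<=` [set w | c <= Q k' w] ->
    (c%:E * P A <= \int[P]_(w in A) (Q k' w)%:E)%E.
  move=> mk' mA Ac; rewrite -integral_cst//; apply: ge0_le_integral => //.
  by apply/measurable_EFinP; apply: measurable_funTS; exact: mQ.
have mc k' : (m <= k')%N -> measurable [set w | c <= Q k' w].
  by move=> mk'; apply: mF; exact: adaptedQ.
elim: k => [|k IH].
  rewrite leqn0 => /eqP m0; rewrite -m0 exceed_m; apply: base => //.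
  exact: mc.
rewrite leq_eqVlt => /predU1P[<-|].
  by rewrite exceed_m; apply: base => //; exact: mc.
rewrite ltnS => mk; rewrite exceedS//.
set B := _ `\` _.
have mk1 : (m <= k.+1)%N := leq_trans mk (leqnSn k).
have mB : measurable B.
  by apply: measurableD; [exact: mc|exact: measurable_exceed].
have mE := measurable_exceed c mk.
have dis : [disjoint exceed c k & B] by rewrite disj_set2E setDIK.
rewrite measureU//; last by rewrite setDIK.
rewrite ge0_muleDr// ge0_integral_setU//; last 2 first.
- by apply/measurable_EFinP; apply: measurable_funTS; exact: mQ.
- by move=> w _; rewrite lee_fin.
apply: leeD; last by apply: base => // w [].
apply: le_trans (IH mk) _; apply: subQ => //; exact: F_exceed.
Qed.

(** The estimate up to a finite horizon k does not depend on k, so it passes to the increasing union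
    of the events [exceed]. *)
Lemma doob_maximal (c r : R) : 0 < c ->
  (forall k, (m <= k)%N -> (\int[P]_w (Q k w)%:E <= r%:E)%E) ->
  measurable [set w | exists2 k, (m <= k)%N & c <= Q k w] /\
  (P [set w | exists2 k, (m <= k)%N & (c <= Q k w)%R] <= (r / c)%:E)%E.
Proof.
move=> c0 Qr.
have -> : [set w | exists2 k, (m <= k)%N & c <= Q k w] =
    \bigcup_k exceed c (m + k)%N.
  apply/seteqP; split=> w.
    move=> [k mk Qk]; exists (k - m)%N => //; exists k => //.
    by rewrite mk subnKC//=.
  by move=> [k _ [j /andP[mj _] Qj]]; exists j.
have mU : measurable (\bigcup_k exceed c (m + k)%N).
  by apply: bigcupT_measurable => k; apply: measurable_exceed; exact: leq_addr.
split => //.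
have nd : nondecreasing_seq (fun k => exceed c (m + k)%N).
  move=> i j ij; apply/subsetPset => w [l /andP[ml li] Ql].
  by exists l => //; rewrite ml (leq_trans li)// leq_add2l.
have cv := nondecreasing_cvg_mu (mu := P)
  (fun k => measurable_exceed c (leq_addr k m)) mU nd.
rewrite -(cvg_lim _ cv)//; apply: lime_le; first by apply/cvg_ex; eexists; exact: cv.
apply: nearW => k /=.
have mk := leq_addr k m.
rewrite mulrC EFinM lee_pdivlMl//.
apply: le_trans (exceed_le (ltW c0) mk) _.
apply: le_trans _ (Qr _ mk).
apply: ge0_subset_integral => //.
- exact: measurable_exceed.
- exact/measurable_EFinP/mQ.
- by move=> w _; rewrite lee_fin.
Qed.

End MaximalInequality.

(** [Q m k] measures the variation between times m and k. For each level c, the event that [Q m]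
    ever reaches c has probability at most (tail of b from m) / c, so the intersection of these
    events over m is null; the levels 1/(n+1) suffice. *)
Lemma ae_cauchy_of_submartingale (R : realType) d (Omega : measurableType d)
    (P : probability Omega R) (F : nat -> set (set Omega))
    (Q : nat -> nat -> Omega -> R) (b : nat -> R) :
  (forall k, sigma_algebra setT (F k)) -> (forall k, F k `<=` measurable) ->
  (forall k, F k `<=` F k.+1) ->
  (forall m k w, 0 <= Q m k w) ->
  (forall m k c, (m <= k)%N -> F k [set w | c <= Q m k w]) ->
  (forall m k, (m <= k)%N -> measurable_fun setT (Q m k)) ->
  (forall m k A, (m <= k)%N -> F k A ->
    (\int[P]_(w in A) (Q m k w)%:E <= \int[P]_(w in A) (Q m k.+1 w)%:E)%E) ->
  (forall m k, (m <= k)%N ->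
    (\int[P]_w (Q m k w)%:E <= (\sum_(m <= i < k) b i)%:E)%E) ->
  (forall e : R, 0 < e -> exists m, forall k, \sum_(m <= i < k) b i < e) ->
  {ae P, forall w, forall e : R, 0 < e -> exists m, forall k, (m <= k)%N ->
     Q m k w < e}.
Proof.
move=> sF mF ndF Q0 aQ mQ subQ Qb btail.
pose S m (c : R) := [set w | exists2 k, (m <= k)%N & c <= Q m k w].
have SP e c : 0 < e -> 0 < c -> exists2 m, measurable (S m c) & (P (S m c) <= e%:E)%E.
  move=> e0 c0; have [m hm] := btail (e * c) (mulr_gt0 e0 c0).
  have Qe k : (m <= k)%N -> (\int[P]_w (Q m k w)%:E <= (e * c)%:E)%E.
    by move=> mk; apply: le_trans (Qb _ _ mk) _; rewrite lee_fin ltW.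
  have [mS PS] := doob_maximal sF mF ndF (Q0 m) (aQ m) (mQ m) (subQ m) c0 Qe.
  by exists m => //; rewrite mulfK ?gt_eqF// in PS.
have N c : 0 < c -> P.-negligible (\bigcap_m S m c).
  move=> c0.
  have /choice[g hg] n : exists m, measurable (S m c) /\ (P (S m c) <= (n.+1%:R^-1)%:E)%E.
    have n0 : 0 < n.+1%:R^-1 :> R by rewrite invr_gt0.
    by have [m] := SP _ c n0 c0; exists m.
  exists (\bigcap_n S (g n) c); split.
  - by apply: bigcapT_measurable => n; exact: (hg n).1.
  - apply/eqP; rewrite eq_le measure_ge0 andbT.
    apply/lee_addgt0Pr => e e0; rewrite add0e.
    have [n _ hn] := near_infty_natSinv_lt (PosNum e0).
    apply: (@le_trans _ _ (P (S (g n) c))).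
      apply: le_measure; rewrite ?inE.
      + by apply: bigcapT_measurable => k; exact: (hg k).1.
      + exact: (hg n).1.
      + exact: bigcap_inf.
    by apply: le_trans (hg n).2 _; rewrite lee_fin ltW//; exact: hn (leqnn n).
  - by move=> w h n _; exact: h.
apply: negligibleS (negligible_bigcup (fun n => N n.+1%:R^-1 _)); last first.
  by move=> n; rewrite invr_gt0.
move=> w /= h; apply: contrapT => nh; apply: h => e e0.
have [n _ hn] := near_infty_natSinv_lt (PosNum e0).
apply: contrapT => hm; apply: nh; exists n => // m _.
apply: contrapT => hS; apply: hm; exists m => k mk.
apply: lt_trans (hn _ (leqnn n)); rewrite ltNge; apply/negP => Qk.
by apply: hS; exists k.
Qed.

(** * Tails of series and almost sure summability *)

Section SeriesTails.
Context (R : realType).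

Lemma ge0_bounded_tail (u : nat -> R) (B : R) : (forall i, 0 <= u i) ->
  (forall k, \sum_(0 <= i < k) u i <= B) ->
  forall e : R, 0 < e -> exists N, forall k, \sum_(N <= i < k) u i < e.
Proof.
move=> u0 uB e e0.
pose s k := \sum_(0 <= i < k) u i.
have ns : nondecreasing_seq s.
  by apply/nondecreasing_seqP => k; rewrite /s big_nat_recr//= lerDl.
have cs : cvgn s.
  by apply: nondecreasing_is_cvgn => //; exists B => _ [k _ <-]; exact: uB.
have /cvgrPdist_lt/(_ _ e0)[N _ hN] := cs.
exists N => k; have [kN|Nk] := leqP k N; first by rewrite big_geq.
have sk : s k <= limn s := nondecreasing_cvgn_le ns cs k.
have : s k = s N + \sum_(N <= i < k) u i.
  by rewrite /s (@big_cat_nat _ _ _ N)//= ltnW.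
have := hN N (leqnn N) => /=; rewrite -/s ltr_norml => /andP[_ h1].
by lra.
Qed.

Lemma nneseries_lty_bounded (u : nat -> R) : (forall i, 0 <= u i) ->
  (\sum_(0 <= k <oo) (u k)%:E < +oo)%E ->
  exists B, forall k, \sum_(0 <= i < k) u i <= B.
Proof.
move=> u0 uoo.
have ge0 : (0 <= \sum_(0 <= k <oo) (u k)%:E)%E.
  by apply: nneseries_ge0 => i _ _; rewrite lee_fin.
exists (fine (\sum_(0 <= k <oo) (u k)%:E)%E) => k.
rewrite -lee_fin fineK; last by rewrite ge0_fin_numE.
rewrite -sumEFin; apply: nneseries_lim_ge => i _ _.
by rewrite lee_fin.
Qed.

Lemma nneseries_pinfty_unbounded (u : nat -> R) : (forall i, 0 <= u i) ->
  (\sum_(0 <= k <oo) (u k)%:E = +oo)%E ->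
  forall N (B : R), exists k, B < \sum_(N <= i < k) u i.
Proof.
move=> u0 uoo N B; apply: contrapT => hB.
have bnd k : \sum_(0 <= i < k) u i <= \sum_(0 <= i < N) u i + `|B|.
  have [kN|Nk] := leqP k N.
    rewrite (le_trans _ (_ : \sum_(0 <= i < N) u i <= _)) ?lerDl//.
    by rewrite [leRHS](@big_cat_nat _ _ _ k)//= lerDl; exact: sumr_ge0.
  rewrite (@big_cat_nat _ _ _ N)//= ?(ltnW Nk)// lerD2l.
  apply: le_trans (ler_norm _); rewrite leNgt; apply/negP => h.
  by apply: hB; exists k.
suff : (\sum_(0 <= k <oo) (u k)%:E <= (\sum_(0 <= i < N) u i + `|B|)%:E)%E.
  by rewrite uoo.
apply: lime_le; first by apply: is_cvg_nneseries => i _ _; rewrite lee_fin.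
by apply: nearW => k; rewrite sumEFin lee_fin.
Qed.

(** Partial sums of nonnegative terms increase pathwise, so they satisfy the submartingale
    inequality for the constant filtration of all measurable sets, and the maximal inequality
    applies. *)
Lemma ae_summable d (Omega : measurableType d) (P : probability Omega R)
    (f : nat -> Omega -> R) (B : R) :
  (forall k w, 0 <= f k w) -> (forall k, measurable_fun setT (f k)) ->
  (forall k, (\sum_(0 <= i < k) \int[P]_w (f i w)%:E <= B%:E)%E) ->
  {ae P, forall w, forall e : R, 0 < e -> exists N, forall k,
     \sum_(N <= i < k) f i w < e}.
Proof.
move=> f0 mf fB.
have If0 i : (0 <= \int[P]_w (f i w)%:E)%E.
  by apply: integral_ge0 => w _; rewrite lee_fin.
have Ifin i : (\int[P]_w (f i w)%:E)%E \is a fin_num.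
  rewrite ge0_fin_numE//; apply: le_lt_trans (ltry B).
  apply: le_trans _ (fB i.+1); rewrite big_nat_recr//= leeDr//.
  by apply: sume_ge0 => j _.
pose b i := fine (\int[P]_w (f i w)%:E)%E.
have bE i : (\int[P]_w (f i w)%:E)%E = (b i)%:E by rewrite /b fineK.
have b0 i : 0 <= b i by exact: fine_ge0.
have bB k : \sum_(0 <= i < k) b i <= B.
  by rewrite -lee_fin -sumEFin; under eq_bigr do rewrite -bE.
pose Q m k w := \sum_(m <= i < k) f i w.
have mQ m k : measurable_fun setT (Q m k) by exact: measurable_sum.
have Q0 m k w : 0 <= Q m k w by apply: sumr_ge0.
have mm : sigma_algebra [set: Omega] measurable by exact: sigma_algebra_measurable.
apply: filterS (@ae_cauchy_of_submartingale _ _ _ P (fun=> measurable) Q b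
  (fun=> mm) (fun=> @subset_refl _ _) (fun=> @subset_refl _ _) Q0 _ _ _ _ _).
- move=> w h e /h[N hN]; exists N => k; have [kN|Nk] := leqP k N.
    by rewrite big_geq//; have := hN N (leqnn N); rewrite /Q big_geq.
  exact/hN/ltnW.
- move=> m k c _; rewrite -[X in measurable X]setTI.
  have := mQ m k measurableT _ (measurable_itv `[c, +oo[).
  by congr measurable; apply/seteqP; split => w [_ /=]; rewrite ?in_itv/= ?andbT.
- by move=> m k _; exact: mQ.
- move=> m k A mk mA; apply: ge0_le_integral => //.
  + by move=> w _; rewrite lee_fin.
  + by apply/measurable_EFinP; apply: measurable_funTS; exact: mQ.
  + by apply/measurable_EFinP; apply: measurable_funTS; exact: mQ.
  + by move=> w _; rewrite lee_fin /Q big_nat_recr//= lerDl.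
- move=> m k mk; rewrite /Q.
  under eq_integral do rewrite -sumEFin.
  rewrite ge0_integral_sum//.
  + by rewrite -sumEFin; apply: lee_sum => i _; rewrite bE.
  + by move=> i; exact/measurable_EFinP.
  + by move=> i w _; rewrite lee_fin.
- exact: ge0_bounded_tail bB.
Qed.

End SeriesTails.

(** * Submartingales driven by independent samples *)

Section PastCauchy.
Context (R : realType) (dO dE : measure_display).
Context (Omega : measurableType dO) (E : measurableType dE).
Context (P : probability Omega R) (xi : nat -> {RV P >-> E}).
Context (D : probability E R).
Hypothesis hlaw : forall k (A : set E), measurable A ->
  distribution P (xi k) A = D A.
Hypothesis hindep : mutually_independent xi.
Local Notation past_type k := (g_sigma_algebraType (past xi k)).

Lemma integral_past_le k (q : past_type k * E -> R) (g : Omega -> \bar R) :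
  measurable_fun setT q -> (forall z, 0 <= q z) ->
  measurable_fun setT g ->
  (forall w, (\int[D]_e (q (w, e))%:E <= g w)%E) ->
  (\int[P]_w (q (w, xi k w))%:E <= \int[P]_w g w)%E.
Proof.
move=> mq q0 mg qg.
have mEq : measurable_fun setT (EFin \o q) by exact/measurable_EFinP.
have Eq0 z : (0 <= (EFin \o q) z)%E by rewrite /= lee_fin.
rewrite (integral_past_tonelli hlaw hindep mEq Eq0).
apply: ge0_le_integral => //.
- by move=> w _; apply: integral_ge0 => e _; exact: Eq0.
- apply: (@measurable_fun_past _ _ _ _ _ _ xi _ _ k).
  exact: (@measurable_fun_fubini_tonelli_F _ _ (past_type k) E R D _ mEq Eq0).
- by move=> w _; exact: qg.
Qed.

(** The indicator of [A] depends on the past only, so it can be absorbed into [q] before the fresh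
    sample is integrated. *)
Lemma integral_past_ge k (q : past_type k * E -> R) (f : Omega -> R) A :
  measurable_fun setT q -> (forall z, 0 <= q z) ->
  measurable_fun setT f -> (forall w, 0 <= f w) ->
  (forall w, ((f w)%:E <= \int[D]_e (q (w, e))%:E)%E) ->
  <<s past xi k >> A ->
  (\int[P]_(w in A) (f w)%:E <= \int[P]_(w in A) (q (w, xi k w))%:E)%E.
Proof.
move=> mq q0 mf f0 fq sA.
have mA : measurable A := past_measurable sA.
pose qA (z : past_type k * E) := (\1_A z.1 * q z)%R : R.
have mqA : measurable_fun setT (EFin \o qA).
  apply/measurable_EFinP; apply: measurable_funM => //.
  exact: (measurableT_comp (f := (\1_A : past_type k -> R))).
have qA0 z : (0 <= (EFin \o qA) z)%E by rewrite /= lee_fin mulr_ge0.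
rewrite !(integral_mkcond A).
have -> : (fun w => (q (w, xi k w))%:E) \_ A = fun w => (EFin \o qA) (w, xi k w).
  apply/funext => w; rewrite /patch /= /qA /= indicE.
  by case: ifP => _; rewrite ?mul1r ?mul0r.
rewrite (integral_past_tonelli hlaw hindep mqA qA0).
apply: ge0_le_integral => //.
- by move=> w _; rewrite /patch; case: ifP => // _; rewrite lee_fin.
- by apply/(measurable_restrictT _ mA).1/measurable_funTS/measurable_EFinP.
- apply: (@measurable_fun_past _ _ _ _ _ _ xi _ _ k).
  exact: (@measurable_fun_fubini_tonelli_F _ _ (past_type k) E R D _ mqA qA0).
- move=> w _; rewrite /patch /= /qA /= indicE; case: ifP => wA.
    by under eq_integral do rewrite mul1r; exact: fq.
  by apply: integral_ge0 => e _; rewrite mul0r.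
Qed.

(** [q m k] writes the next value of [Q m] as a function of the past and the fresh sample. With the
    past frozen, its mean over the sample lies between [Q m k] (submartingale property) and
    [Q m k + g k] (control of the variance). *)
Lemma ae_cauchy_past (Q : nat -> nat -> Omega -> R)
    (q : forall m k, past_type k * E -> R) (g : nat -> Omega -> R) (b : nat -> R) :
  (forall m k w, 0 <= Q m k w) -> (forall m w, Q m m w = 0) ->
  (forall m k, (m <= k)%N -> measurable_fun setT (Q m k : past_type k -> R)) ->
  (forall m k, (m <= k)%N -> measurable_fun setT (q m k)) ->
  (forall m k z, 0 <= q m k z) ->
  (forall m k w, (m <= k)%N -> Q m k.+1 w = q m k (w, xi k w)) ->
  (forall m k w, (m <= k)%N -> ((Q m k w)%:E <= \int[D]_e (q m k (w, e))%:E)%E) ->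
  (forall m k w, (m <= k)%N ->
     (\int[D]_e (q m k (w, e))%:E <= (Q m k w + g k w)%:E)%E) ->
  (forall k w, 0 <= g k w) -> (forall k, measurable_fun setT (g k)) ->
  (forall k, (\int[P]_w (g k w)%:E <= (b k)%:E)%E) ->
  (forall e : R, 0 < e -> exists m, forall k, \sum_(m <= i < k) b i < e) ->
  {ae P, forall w, forall e : R, 0 < e -> exists m, forall k, (m <= k)%N ->
     Q m k w < e}.
Proof.
move=> Q0 Qmm aQ mq q0 Qq ge le g0 mg gb btail.
have mQ m k : (m <= k)%N -> measurable_fun setT (Q m k).
  by move=> mk; exact: (measurable_fun_past (aQ m k mk)).
apply: (@ae_cauchy_of_submartingale _ _ _ _ (fun k => <<s past xi k >>) Q b) => //.
- by move=> k A; exact: past_measurable.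
- by move=> k A; exact: measurable_past_le.
- move=> m k c mk.
  have := aQ m k mk measurableT _ (measurable_itv `[c, +oo[).
  rewrite setTI; congr (<<s _ >> _).
  by apply/seteqP; split => w /=; rewrite in_itv/= andbT.
- move=> m k A mk sA.
  under [in leRHS]eq_integral do rewrite (Qq _ _ _ mk).
  by apply: integral_past_ge => //; [exact: mq|exact: mQ|move=> w; exact: ge].
- move=> m k; elim: k => [|k IH].
    rewrite leqn0 => /eqP m0; rewrite big_geq ?m0//.
    by rewrite integral0_eq// => w _; rewrite -m0 Qmm.
  rewrite leq_eqVlt => /predU1P[<-|].
    by rewrite big_geq// integral0_eq// => w _; rewrite Qmm.
  rewrite ltnS => mk.
  under eq_integral do rewrite (Qq _ _ _ mk).
  have mQg : measurable_fun setT (fun w => (Q m k w + g k w)%:E).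
    by apply/measurable_EFinP; apply: measurable_funD => //; exact: mQ.
  apply: le_trans (integral_past_le (mq _ _ mk) (q0 m k) mQg (fun w => le _ _ w mk)) _.
  under eq_integral do rewrite EFinD.
  rewrite ge0_integralD//; last 4 first.
  + by move=> w _; rewrite lee_fin.
  + exact/measurable_EFinP/mQ.
  + by move=> w _; rewrite lee_fin.
  + exact/measurable_EFinP.
  by rewrite big_nat_recr//= EFinD leeD// IH.
Qed.

End PastCauchy.

(** * Almost sure convergence of the iteration *)

Lemma ge0_integral_affine_le (R : realType) d (Omega : measurableType d)
    (P : probability Omega R) (f : Omega -> R) (a b B : R) :
  0 <= a -> 0 <= b -> measurable_fun setT f -> (forall w, 0 <= f w) ->
  (\int[P]_w (f w)%:E <= B%:E)%E ->
  (\int[P]_w (a * f w + b)%:E <= (a * B + b)%:E)%E.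
Proof.
move=> a0 b0 mf f0 fB.
under eq_integral do rewrite EFinD.
rewrite ge0_integralD//; last 2 first.
- by move=> w _; rewrite lee_fin mulr_ge0.
- by apply/measurable_EFinP; exact: measurable_funM.
rewrite integral_cst// [X in (_ + _ * X)%E](@probability_setT _ _ _ P) mule1.
under eq_integral do rewrite EFinM.
rewrite ge0_integralZl_EFin//; last 2 first.
- by move=> w _; rewrite lee_fin.
- exact/measurable_EFinP.
by rewrite EFinD EFinM leeD2r// lee_wpmul2l// lee_fin.
Qed.

Section StochasticKM.
Context (R : realType) (H : completeNormedModType R).
Context (dot : {dot H for @idfun R}).
Hypotheses (hdot : norm_of_dot dot) (hsep : separable_space H).
Context (dE dO : measure_display) (E : measurableType dE).
Context (D : probability E R) (S : E -> H -> H) (T : H -> H).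
Hypotheses (Sne : forall e, nonexpansive (S e))
  (mS : forall x, weakly_measurable dot (S ^~ x)).
Hypothesis ST : forall x y,
  D.-integrable setT (EFin \o (fun e => dot (S e x) y)) /\
  dot (T x) y = \int[D]_e dot (S e x) y.
Context (Omega : measurableType dO) (P : probability Omega R).
Context (xi : nat -> {RV P >-> E}).
Hypothesis hlaw : forall k (A : set E), measurable A ->
  distribution P (xi k) A = D A.
Hypothesis hindep : mutually_independent xi.
Context (lambda : nat -> R) (kappa L : R) (x0 : H).
Hypotheses (lambda_gt0 : forall k, 0 < lambda k)
  (lambda_le : forall k, lambda k <= kappa) (kappa_lt1 : kappa < 1)
  (lambda_sqr : forall k, \sum_(0 <= i < k) lambda i ^+ 2 <= L).

Local Notation past_type k := (g_sigma_algebraType (past xi k)).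
Let X k w := skm S lambda (fun k => xi k) x0 k w.

Let kappa_gt0 : 0 < kappa := lt_le_trans (lambda_gt0 0) (lambda_le 0).
Let Tne : nonexpansive T := mean_operator_nonexpansive hdot Sne ST.
Let lambda_ge0 k : 0 <= lambda k := ltW (lambda_gt0 k).

Let XS k w : X k.+1 w = X k w + lambda k *: (S (xi k w) (X k w) - X k w).
Proof. by rewrite /X /=; dot_ring hdot. Qed.

(** [T] is treated as a family of nonexpansive maps that is constant in the sample. *)
Let mT d (Y : measurableType d) (f : Y -> H) :
  weakly_measurable dot f -> weakly_measurable dot (T \o f).
Proof.
move=> mf; apply: (weakly_measurable_nonexpansive hdot hsep
  (S := fun=> T) (u := fun=> point : E) (f := f)) => //.
by move=> x; exact: weakly_measurable_cst.
Qed.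

Let weakly_past_le j k (f : Omega -> H) : (j <= k)%N ->
  weakly_measurable dot (f : past_type j -> H) ->
  weakly_measurable dot (f : past_type k -> H).
Proof. by move=> jk mf y; exact: measurable_fun_past_le jk (mf y). Qed.

Let weakly_past k (f : Omega -> H) :
  weakly_measurable dot (f : past_type k -> H) -> weakly_measurable dot f.
Proof. by move=> mf y; exact: measurable_fun_past (mf y). Qed.

(** The indices matter: [X k] is built from xi_0, ..., xi_(k-1), exactly the samples of [past k], so
    xi_k is still fresh at step k. *)
Lemma skm_adapted k : weakly_measurable dot (X k : past_type k -> H).
Proof.
elim: k => [|k IH]; first exact: weakly_measurable_cst.
have mX := weakly_past_le (leqnSn k) IH.
have -> : X k.+1 = fun w => X k w + lambda k *: (S (xi k w) (X k w) - X k w).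
  by apply/funext => w; exact: XS.
apply: weakly_measurableD => //; apply: weakly_measurableZ => //.
apply: weakly_measurableB => //.
apply: (weakly_measurable_nonexpansive hdot hsep Sne mS) => //.
exact: measurable_xi_past.
Qed.

Let mX k : weakly_measurable dot (X k).
Proof. exact: weakly_past (@skm_adapted k). Qed.

Let mXfst k : weakly_measurable dot (fun z : past_type k * E => X k z.1).
Proof. exact: (weakly_measurable_comp (@skm_adapted k) measurable_fst). Qed.

Let mSX k : weakly_measurable dot (fun z : past_type k * E => S z.2 (X k z.1)).
Proof. exact: (weakly_measurable_nonexpansive hdot hsep Sne mS). Qed.

Context (p : H).
Hypothesis Tp : T p = p.
Hypothesis iVp : D.-integrable setT (EFin \o (fun e => `|S e p - p| ^+ 2)).

Let sigma2 := \int[D]_e `|S e p - p| ^+ 2.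
Let c := (1 - kappa) / 2.
Let C := (1 + kappa) / (1 - kappa).
Let Y k w := `|X k w - p| ^+ 2.
Let r k w := `|T (X k w) - X k w|.
(** The initial energy plus everything the noise can add: the steps contribute C lambda_k^2 sigma2,
    and L bounds the sum of the lambda_k^2. *)
Let B := `|x0 - p| ^+ 2 + C * sigma2 * L.

Let c_gt0 : 0 < c. Proof. by rewrite /c; move: kappa_lt1; lra. Qed.
Let C_ge0 : 0 <= C.
Proof.
by rewrite /C divr_ge0//; move: kappa_gt0 kappa_lt1; lra.
Qed.
Let sigma2_ge0 : 0 <= sigma2.
Proof. by apply: Rintegral_ge0 => e _; exact: sqr_ge0. Qed.
Let L_ge0 : 0 <= L.
Proof. by apply: le_trans (lambda_sqr 0); rewrite big_geq. Qed.

Let mY k : measurable_fun setT (Y k).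
Proof.
by apply: (measurable_sqr_norm hdot hsep); exact: weakly_measurableB.
Qed.

Let mr k : measurable_fun setT (fun w => r k w ^+ 2).
Proof.
apply: (measurable_sqr_norm hdot hsep); apply: weakly_measurableB => //.
exact: mT.
Qed.

(** The mean one-step inequality with the past frozen, then integrated over the past. The residual
    stands on the left as a summand because finiteness of these integrals is only a consequence. *)
Let energy_step k :
  (\int[P]_w (Y k.+1 w)%:E + \int[P]_w (c * lambda k * r k w ^+ 2)%:E <=
   \int[P]_w (Y k w)%:E + (C * lambda k ^+ 2 * sigma2)%:E)%E.
Proof.
have cl0 : 0 <= c * lambda k by rewrite mulr_ge0// ltW.
have rk0 w : 0 <= c * lambda k * r k w ^+ 2 by rewrite mulr_ge0// sqr_ge0.
have s0 : 0 <= C * lambda k ^+ 2 * sigma2 by rewrite mulr_ge0// mulr_ge0// sqr_ge0.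
rewrite -ge0_integralD//; last 4 first.
- by move=> w _; rewrite lee_fin sqr_ge0.
- exact/measurable_EFinP.
- by move=> w _; rewrite lee_fin.
- by apply/measurable_EFinP; exact: measurable_funM.
have -> : (\int[P]_w (Y k w)%:E + (C * lambda k ^+ 2 * sigma2)%:E)%E =
    (\int[P]_w (Y k w + C * lambda k ^+ 2 * sigma2)%:E)%E.
  under [RHS]eq_integral do rewrite EFinD.
  rewrite ge0_integralD//; last 2 first.
  - by move=> w _; rewrite lee_fin sqr_ge0.
  - exact/measurable_EFinP.
  by rewrite integral_cst// [X in (_ + _ * X)%E](@probability_setT _ _ _ P) mule1.
pose q (z : past_type k * E) : R :=
  `|X k z.1 + lambda k *: (S z.2 (X k z.1) - X k z.1) - p| ^+ 2
  + c * lambda k * r k z.1 ^+ 2.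
under eq_integral do rewrite -EFinD.
rewrite (eq_integral (fun w => (q (w, xi k w))%:E)); last first.
  by move=> w _; rewrite /q /= /Y XS.
apply: (integral_past_le hlaw hindep).
- apply: measurable_funD.
    apply: (measurable_sqr_norm hdot hsep); apply: weakly_measurableB.
      apply: weakly_measurableD => //; apply: weakly_measurableZ => //.
      exact: weakly_measurableB.
    exact: weakly_measurable_cst.
  apply: measurable_funM => //.
  apply: (measurable_sqr_norm hdot hsep
    (f := fun z : past_type k * E => T (X k z.1) - X k z.1)).
  by apply: weakly_measurableB => //; exact: mT.
- by move=> z; rewrite addr_ge0 ?sqr_ge0 ?rk0.
- by apply/measurable_EFinP; exact: measurable_funD.
- move=> w.
  under eq_integral do rewrite EFinD /=.
  rewrite ge0_integralD//; last 2 first.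
  + apply/measurable_EFinP.
    apply: (measurable_sqr_norm hdot hsep).
    apply: weakly_measurableB; last exact: weakly_measurable_cst.
    apply: weakly_measurableD; first exact: weakly_measurable_cst.
    by apply: weakly_measurableZ => //; apply: weakly_measurableB.
  + by move=> e _; rewrite lee_fin.
  rewrite integral_cst// [X in (_ + _ * X)%E](@probability_setT _ _ _ D) mule1.
  exact: (km_step_mean hdot hsep Sne mS ST Tp iVp).
Qed.

Lemma skm_energy k :
  (\int[P]_w (Y k w)%:E
    + \sum_(0 <= i < k) \int[P]_w (c * lambda i * r i w ^+ 2)%:E <= B%:E)%E.
Proof.
apply: (@le_trans _ _
  (`|x0 - p| ^+ 2 + C * sigma2 * \sum_(0 <= i < k) lambda i ^+ 2)%:E); last first.
  by rewrite lee_fin lerD2l ler_wpM2l// mulr_ge0.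
elim: k => [|k IH].
  rewrite !big_geq// mulr0 adde0 addr0.
  rewrite [leLHS](integral_cst P measurableT (`|x0 - p| ^+ 2)%:E).
  by rewrite [X in (_ * X)%E](@probability_setT _ _ _ P) mule1.
rewrite !big_nat_recr//=.
rewrite (_ : `|x0 - p| ^+ 2 + _ = (`|x0 - p| ^+ 2
    + C * sigma2 * \sum_(0 <= i < k) lambda i ^+ 2)
    + C * lambda k ^+ 2 * sigma2); last by ring.
rewrite EFinD; move: (energy_step k) IH.
move: (\int[P]_w (Y k w)%:E)%E (\int[P]_w (Y k.+1 w)%:E)%E => y y'.
move: (\int[P]_w (c * lambda k * r k w ^+ 2)%:E)%E (\sum_(0 <= i < k) _) => u s.
move=> h1 h2; rewrite [X in (_ + X <= _)%E]addeC addeA.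
by apply: le_trans (leeD h1 (lexx s)) _; rewrite addeAC; exact: leeD.
Qed.

Lemma skm_second_moment k : (\int[P]_w (`|X k w - p| ^+ 2)%:E <= B%:E)%E.
Proof.
apply: le_trans (skm_energy k); rewrite leeDl//; apply: sume_ge0 => i _.
apply: integral_ge0 => w _.
by rewrite lee_fin mulr_ge0 ?sqr_ge0// mulr_ge0 ?ltW.
Qed.

Lemma skm_residual_summable :
  {ae P, forall w, forall e : R, 0 < e -> exists N, forall k,
     \sum_(N <= i < k) lambda i * `|T (X i w) - X i w| ^+ 2 < e}.
Proof.
have h : {ae P, forall w, forall e : R, 0 < e -> exists N, forall k,
    \sum_(N <= i < k) c * lambda i * r i w ^+ 2 < e}.
  apply: (@ae_summable _ _ _ _ _ B).
  - by move=> k w; rewrite mulr_ge0 ?sqr_ge0// mulr_ge0 ?ltW.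
  - by move=> k; exact: measurable_funM.
  - move=> k; apply: le_trans (skm_energy k); rewrite leeDr//.
    by apply: integral_ge0 => w _; rewrite lee_fin sqr_ge0.
apply: filterS h => w h e e0.
have [N hN] := h (c * e) (mulr_gt0 c_gt0 e0).
exists N => k; rewrite -(ltr_pM2l c_gt0); apply: le_lt_trans (hN k).
by rewrite mulr_sumr; under [leRHS]eq_bigr do rewrite -mulrA.
Qed.

Let M k w := \sum_(0 <= i < k) lambda i *: (S (xi i w) (X i w) - T (X i w)).

Let MS k w : M k.+1 w = M k w + lambda k *: (S (xi k w) (X k w) - T (X k w)).
Proof. by rewrite /M big_nat_recr. Qed.

Let noise_adapted k : weakly_measurable dot (M k : past_type k -> H).
Proof.
elim: k => [|k IH].
  have -> : M 0 = fun=> 0 by apply/funext => w; rewrite /M big_geq.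
  exact: weakly_measurable_cst.
have mX' := weakly_past_le (leqnSn k) (@skm_adapted k).
have -> : M k.+1 = fun w => M k w + lambda k *: (S (xi k w) (X k w) - T (X k w)).
  by apply/funext => w; exact: MS.
apply: weakly_measurableD; first exact: weakly_past_le (leqnSn k) IH.
apply: weakly_measurableZ => //; apply: weakly_measurableB; last exact: mT.
apply: (weakly_measurable_nonexpansive hdot hsep Sne mS) => //.
exact: measurable_xi_past.
Qed.

Let tail_lambda (K : R) : 0 <= K -> forall e : R, 0 < e ->
  exists m, forall k, \sum_(m <= i < k) (lambda i ^+ 2 * K) < e.
Proof.
move=> K0; apply: (@ge0_bounded_tail _ _ (L * K)) => [i|k].
  by rewrite mulr_ge0 ?sqr_ge0.
by rewrite -mulr_suml ler_wpM2r.
Qed.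

Let B_ge0 : 0 <= B.
Proof. by rewrite addr_ge0 ?sqr_ge0// mulr_ge0// mulr_ge0. Qed.

Lemma skm_noise_cauchy :
  {ae P, forall w, forall e : R, 0 < e -> exists m, forall k, (m <= k)%N ->
    `|M k w - M m w| ^+ 2 < e}.
Proof.
pose q m k (z : past_type k * E) : R :=
  `|(M k z.1 - M m z.1) + lambda k *: (S z.2 (X k z.1) - T (X k z.1))| ^+ 2.
pose g k w := lambda k ^+ 2 * 8 * `|X k w - p| ^+ 2 + lambda k ^+ 2 * (2 * sigma2).
(* With the past frozen, M_k - M_m is a constant vector and the new increment is centered. *)
have qE m k w : (\int[D]_e (q m k (w, e))%:E)%E = (`|M k w - M m w| ^+ 2
    + lambda k ^+ 2 * \int[D]_e `|S e (X k w) - T (X k w)| ^+ 2)%:E.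
  rewrite /q /=; apply: (@centered_sqr _ _ _ hdot _ _ _ (fun e => S e (X k w) - T (X k w))).
  - by apply: weakly_measurableB => //; exact: weakly_measurable_cst.
  - exact: centered_mean_operator.
  - exact: (integrable_noise hdot hsep Sne mS ST Tp iVp).
apply: (@ae_cauchy_past _ _ _ _ _ _ _ _ hlaw hindep
  (fun m k w => `|M k w - M m w| ^+ 2) q g
  (fun k => lambda k ^+ 2 * (8 * B + 2 * sigma2))).
- by move=> m k w; exact: sqr_ge0.
- by move=> m w; rewrite subrr normr0 expr0n.
- move=> m k mk; apply: (measurable_sqr_norm hdot hsep).
  apply: weakly_measurableB; first exact: noise_adapted.
  exact: weakly_past_le mk (@noise_adapted m).
- move=> m k mk; apply: (measurable_sqr_norm hdot hsep).
  have mf f : weakly_measurable dot (f : past_type k -> H) ->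
      weakly_measurable dot (fun z : past_type k * E => f z.1).
    by move=> hf; exact: (weakly_measurable_comp hf measurable_fst).
  apply: weakly_measurableD.
    apply: weakly_measurableB; first exact: mf.
    by apply: mf; exact: weakly_past_le mk (@noise_adapted m).
  by apply: weakly_measurableZ => //; apply: weakly_measurableB => //; exact: mT.
- by move=> m k z; exact: sqr_ge0.
- by move=> m k w mk; rewrite /q /= MS addrAC.
- move=> m k w mk; rewrite qE lee_fin lerDl mulr_ge0 ?sqr_ge0//.
  by apply: Rintegral_ge0 => e _; exact: sqr_ge0.
- move=> m k w mk; rewrite qE lee_fin lerD2l /g -mulrA -mulrDr.
  by rewrite ler_wpM2l ?sqr_ge0//; exact: (noise_second_moment hdot hsep Sne mS ST Tp iVp).
- by move=> k w; rewrite addr_ge0// mulr_ge0 ?sqr_ge0// mulr_ge0 ?sqr_ge0.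
- by move=> k; apply: measurable_funD => //; apply: measurable_funM => //; exact: mY.
- move=> k; rewrite (_ : lambda k ^+ 2 * _ = lambda k ^+ 2 * 8 * B
    + lambda k ^+ 2 * (2 * sigma2)); last by ring.
  apply: ge0_integral_affine_le => //.
  + by rewrite mulr_ge0 ?sqr_ge0.
  + by rewrite mulr_ge0 ?sqr_ge0// mulr_ge0.
  + exact: mY.
  + exact: skm_second_moment.
- by apply: tail_lambda; rewrite addr_ge0 ?mulr_ge0.
Qed.

Let s k w := \sum_(0 <= i < k) lambda i * dot (S (xi i w) p - p) (X i w - p).

Let sS k w : s k.+1 w = s k w + lambda k * dot (S (xi k w) p - p) (X k w - p).
Proof. by rewrite /s big_nat_recr. Qed.

Let s_adapted k : measurable_fun setT (s k : past_type k -> R).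
Proof.
elim: k => [|k IH].
  have -> : s 0 = fun=> 0 by apply/funext => w; rewrite /s big_geq.
  exact: measurable_cst.
have -> : s k.+1 = fun w => s k w + lambda k * dot (S (xi k w) p - p) (X k w - p).
  by apply/funext => w; exact: sS.
apply: measurable_funD; first exact: measurable_fun_past_le (leqnSn k) IH.
apply: measurable_funM => //; apply: (measurable_dot hdot hsep).
  apply: weakly_measurableB; last exact: weakly_measurable_cst.
  apply: (weakly_measurable_comp (u := xi k : past_type k.+1 -> E) (mS p)).
  exact: measurable_xi_past.
apply: weakly_measurableB; last exact: weakly_measurable_cst.
exact: weakly_past_le (leqnSn k) (@skm_adapted k).
Qed.

Lemma skm_cross_cauchy :
  {ae P, forall w, forall e : R, 0 < e -> exists m, forall k, (m <= k)%N ->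
    (s k w - s m w) ^+ 2 < e}.
Proof.
pose q m k (z : past_type k * E) : R :=
  ((s k z.1 - s m z.1) + lambda k * dot (S z.2 p - p) (X k z.1 - p)) ^+ 2.
(* The summand 0 gives [g] the affine shape expected by [ge0_integral_affine_le]. *)
pose g k w := lambda k ^+ 2 * sigma2 * `|X k w - p| ^+ 2 + 0.
have mV : weakly_measurable dot (fun e => S e p - p).
  by apply: weakly_measurableB => //; exact: weakly_measurable_cst.
have cV : centered dot D (fun e => S e p - p).
  by rewrite -{2}Tp; exact: centered_mean_operator.
have qE m k w : (((s k w - s m w) ^+ 2)%:E <= \int[D]_e (q m k (w, e))%:E <=
    ((s k w - s m w) ^+ 2 + lambda k ^+ 2 * (`|X k w - p| ^+ 2 * sigma2))%:E)%E.
  rewrite /q /=; exact: (centered_dot_sqr hdot (X k w - p) (s k w - s m w)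
    (lambda k) mV cV iVp).
apply: (@ae_cauchy_past _ _ _ _ _ _ _ _ hlaw hindep
  (fun m k w => (s k w - s m w) ^+ 2) q g
  (fun k => lambda k ^+ 2 * (sigma2 * B))).
- by move=> m k w; exact: sqr_ge0.
- by move=> m w; rewrite subrr expr0n.
- move=> m k mk; apply: measurable_funX; apply: measurable_funB => //.
  exact: measurable_fun_past_le mk (@s_adapted m).
- move=> m k mk; apply: measurable_funX; apply: measurable_funD.
    apply: measurable_funB.
      exact: (measurableT_comp (@s_adapted k) measurable_fst).
    exact: (measurableT_comp (measurable_fun_past_le mk (@s_adapted m)) measurable_fst).
  apply: measurable_funM => //; apply: (measurable_dot hdot hsep).
    exact: (weakly_measurable_comp mV measurable_snd).
  by apply: weakly_measurableB => //; exact: weakly_measurable_cst.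
- by move=> m k z; exact: sqr_ge0.
- by move=> m k w mk; rewrite /q /= sS addrAC.
- by move=> m k w mk; have /andP[] := qE m k w.
- move=> m k w mk; have /andP[_] := qE m k w.
  by rewrite /g addr0 -mulrA [sigma2 * _]mulrC.
- by move=> k w; rewrite /g addr0 mulr_ge0 ?sqr_ge0// mulr_ge0 ?sqr_ge0.
- by move=> k; apply: measurable_funD => //; apply: measurable_funM => //; exact: mY.
- move=> k; rewrite mulrA -[_ * B]addr0; apply: ge0_integral_affine_le => //.
  + by rewrite mulr_ge0 ?sqr_ge0.
  + exact: mY.
  + exact: skm_second_moment.
- by apply: tail_lambda; rewrite mulr_ge0.
Qed.

(** This is the error term of the pathwise inequality; since xi_i has law D, its total expectation
    is at most L sigma2. *)
Lemma skm_noise_summable :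
  {ae P, forall w, forall e : R, 0 < e -> exists N, forall k,
     \sum_(N <= i < k) lambda i ^+ 2 * `|S (xi i w) p - p| ^+ 2 < e}.
Proof.
apply: (@ae_summable _ _ _ _ _ (L * sigma2)) => [k w|k|k].
- by rewrite mulr_ge0 ?sqr_ge0.
- apply: measurable_funM => //.
  apply: (measurable_sqr_norm hdot hsep (f := fun w => S (xi k w) p - p)).
  apply: weakly_measurableB; last exact: weakly_measurable_cst.
  exact: (weakly_measurable_comp (mS p) (measurable_funPT (xi k))).
- have mV : measurable_fun setT (fun e => `|S e p - p| ^+ 2).
    apply: (measurable_sqr_norm hdot hsep).
    by apply: weakly_measurableB => //; exact: weakly_measurable_cst.
  have V i : (\int[P]_w (lambda i ^+ 2 * `|S (xi i w) p - p| ^+ 2)%:E =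
      (lambda i ^+ 2 * sigma2)%:E)%E.
    under eq_integral do rewrite EFinM.
    rewrite ge0_integralZl_EFin ?sqr_ge0//; last first.
      by apply/measurable_EFinP; exact: (measurableT_comp mV (measurable_funPT (xi i))).
    rewrite [RHS]EFinM; congr (_ * _)%E; rewrite /sigma2 EFin_Rintegral//.
    transitivity (\int[distribution P (xi i)]_e (`|S e p - p| ^+ 2)%:E)%E.
      by rewrite ge0_integral_pushforward//; exact/measurable_EFinP.
    by apply: eq_measure_integral => A mA _; exact: hlaw.
  under eq_bigr do rewrite V.
  by rewrite sumEFin lee_fin -mulr_suml ler_wpM2r.
Qed.

Lemma skm_dist_cvg : {ae P, forall w, cvgn (fun k => `|X k w - p|)}.
Proof.
apply: filterS2 skm_cross_cauchy skm_noise_summable => w hs hV.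
have cs : cvgn (s ^~ w).
  apply/cauchy_cvgP/cauchy_exP => e e0.
  have [m hm] := hs (e ^+ 2) (exprn_gt0 2 e0).
  exists (s m w); exists m => // k /= mk; rewrite -ball_normE /= distrC.
  rewrite -ltr_sqr ?nnegrE ?(ltW e0)// real_normK ?num_real//.
  exact: hm.
pose V k := \sum_(0 <= i < k) lambda i ^+ 2 * `|S (xi i w) p - p| ^+ 2.
have cV : cvgn V.
  apply/cauchy_cvgP/cauchy_exP => e e0.
  have [m hm] := hV e e0.
  exists (V m); exists m => // k /= mk; rewrite -ball_normE /= distrC.
  rewrite /V (@big_cat_nat _ _ _ m)//= addrAC subrr add0r ger0_norm//.
  by apply: sumr_ge0 => i _; rewrite mulr_ge0 ?sqr_ge0.
have cY : cvgn (fun k => Y k w).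
  (* The term with |U - V|^2 in the one-step inequality has a favourable sign and is dropped; the
     cross terms and the errors form the convergent comparison sequence. *)
  apply: (@cvg_of_increment_le _ _ (fun k => 2 * s k w + C * V k)).
  - by move=> k; exact: sqr_ge0.
  - move=> k; rewrite /Y XS sS /V big_nat_recr//= -/(V k).
    have := km_step_pointwise hdot Sne p (xi k w) (X k w) kappa_gt0 kappa_lt1
      (lambda_gt0 k) (lambda_le k).
    have : 0 <= (1 - kappa) / 2 * lambda k
        * `|S (xi k w) (X k w) - X k w - (S (xi k w) p - p)| ^+ 2.
      by rewrite mulr_ge0 ?sqr_ge0// mulr_ge0// ltW.
    by rewrite -/C; lra.
  - by apply: is_cvgD; apply: is_cvgM => //; exact: is_cvg_cst.
have -> : (fun k => `|X k w - p|) = Num.sqrt \o (Y ^~ w).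
  by apply/funext => k /=; rewrite /Y sqrtr_sqr normr_id.
by apply/cvg_ex; exists (Num.sqrt (lim (Y k w @[k --> \oo])));
  exact: (cvg_comp _ _ cY (@sqrt_continuous _ _)).
Qed.

Hypothesis lambda_div : forall N (A : R), exists k, A < \sum_(N <= i < k) lambda i.

Lemma skm_residual_cvg : {ae P, forall w, r k w @[k --> \oo] --> 0}.
Proof.
apply: filterS2 skm_noise_cauchy skm_residual_summable => w hM hr.
apply: (@residual_cvg0 _ lambda) => //.
- by move=> k; rewrite lambda_ge0 (le_trans (lambda_le k))// ltW.
- by move=> k; exact: normr_ge0.
move=> e e0.
(* Comparing times j and k through m costs two increments below e / 4, and the residual is
   2-Lipschitz because [T] is nonexpansive, which doubles their sum to e. *)
have [m hm] := hM ((e / 4) ^+ 2) (exprn_gt0 2 (divr_gt0 e0 (ltr0n R 4))).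
have hm' k : (m <= k)%N -> `|M k w - M m w| < e / 4.
  move=> mk; rewrite -ltr_sqr ?nnegrE//; first exact: hm.
  by rewrite divr_ge0// ltW.
exists m => j k mj jk.
have h1 : `|X k w - X j w| <= \sum_(j <= i < k) lambda i * r i w + `|M k w - M j w|.
  have -> : X k w - X j w = \sum_(j <= i < k) lambda i *: (T (X i w) - X i w)
      + (M k w - M j w).
    rewrite -(telescope_sumr (X ^~ w) jk) -(telescope_sumr (M ^~ w) jk) -big_split/=.
    by apply: eq_bigr => i _; rewrite XS MS; dot_ring hdot.
  apply: le_trans (ler_normD _ _) _; rewrite lerD2r.
  apply: le_trans (ler_norm_sum _ _ _) _; apply: ler_sum => i _.
  by rewrite normrZ ger0_norm.
have h2 : `|M k w - M j w| <= e / 2.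
  have := hm' k (leq_trans mj jk); have := hm' j mj.
  have := ler_distD (M m w) (M k w) (M j w); rewrite (distrC (M m w)); lra.
have h3 : r k w - r j w <= 2 * `|X k w - X j w|.
  have h4 := Tne (X k w) (X j w).
  have h5 : r k w <= `|T (X k w) - T (X j w)| + `|T (X j w) - X j w| + `|X j w - X k w|.
    apply: le_trans (ler_distD (X j w) _ _) _; rewrite lerD2r.
    exact: ler_distD.
  by rewrite (distrC (X j w) (X k w)) in h5; rewrite {2}/r; lra.
lra.
Qed.

End StochasticKM.

(** Beyond some N the squares are below 1/4, so the terms are at most 1/2; the finitely many others
    are each below 1, and a maximum bounds them all. *)
Lemma square_summable_le_lt1 (R : realType) (u : nat -> R) (L : R) :
  (forall k, 0 < u k < 1) -> (forall k, \sum_(0 <= i < k) u i ^+ 2 <= L) ->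
  exists2 kappa, kappa < 1 & forall k, u k <= kappa.
Proof.
move=> u01 uL.
have u0 k : 0 <= u k by case/andP: (u01 k) => /ltW.
have [N hN] : exists N, forall k, \sum_(N <= i < k) u i ^+ 2 < 4^-1.
  by apply: (@ge0_bounded_tail _ (fun i => u i ^+ 2) L) => // i; exact: sqr_ge0.
have large k : (N <= k)%N -> u k <= 2^-1.
  move=> Nk; have := hN k.+1; rewrite big_nat_recr//=.
  have : 0 <= \sum_(N <= i < k) u i ^+ 2 by apply: sumr_ge0 => i _; exact: sqr_ge0.
  by have := u0 k; nra.
have [kappa [k1 k2 hk]] : exists kappa, [/\ kappa < 1, 2^-1 <= kappa &
    forall k, (k < N)%N -> u k <= kappa].
  elim: N {hN large} => [|N [kappa [k1 k2 hk]]]; first by exists 2^-1; split => //; lra.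
  exists (Num.max kappa (u N)); split.
  - by rewrite gt_max k1; case/andP: (u01 N).
  - by rewrite le_max k2.
  - move=> k; rewrite ltnS leq_eqVlt => /predU1P[->|kN]; rewrite le_max ?lexx ?orbT//.
    by rewrite hk.
exists kappa => // k; have [kN|Nk] := ltnP k N; first exact: hk.
exact: le_trans (large k Nk) k2.
Qed.

Lemma skm_ae_converges (R : realType) (H : completeNormedModType R)
    (dot : {dot H for @idfun R}) (hdot : norm_of_dot dot)
    (hsep : separable_space H)
    (dE dO : measure_display) (E : measurableType dE) (D : probability E R)
    (S : E -> H -> H) (T : H -> H)
    (Sne : forall e, nonexpansive (S e))
    (mS : forall x, weakly_measurable dot (S ^~ x))
    (ST : forall x y, D.-integrable setT (EFin \o (fun e => dot (S e x) y)) /\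
       dot (T x) y = \int[D]_e dot (S e x) y)
    (Omega : measurableType dO) (P : probability Omega R)
    (xi : nat -> {RV P >-> E})
    (hlaw : forall k (A : set E), measurable A -> distribution P (xi k) A = D A)
    (hindep : mutually_independent xi)
    (lambda : nat -> R) (L : R) (x0 p0 : H)
    (lambda01 : forall k, 0 < lambda k < 1)
    (lambda_sqr : forall k, \sum_(0 <= i < k) lambda i ^+ 2 <= L)
    (lambda_div : forall N (A : R), exists k, A < \sum_(N <= i < k) lambda i)
    (Tp0 : T p0 = p0)
    (iVp0 : D.-integrable setT (EFin \o (fun e => `|S e p0 - p0| ^+ 2))) :
  let x := skm S lambda (fun k => xi k) x0 in
  {ae P, forall w : Omega,
     (fun k => `|T (x k w) - x k w|) @ \oo --> (0 : R) /\
     exists2 p : H, fixed_points T p & weakly_converges dot (fun k => x k w) p}.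
Proof.
move=> x.
have [kappa kappa1 lambda_le] := square_summable_le_lt1 lambda01 lambda_sqr.
have lambda0 k : 0 < lambda k by case/andP: (lambda01 k).
have Fix0 : fixed_points T !=set0 by exists p0.
have [q Fq dq] := separable_seq hsep Fix0.
(* At a fixed point q the noise is S e q - q, so the second moment assumed at [p0] transfers to
   every point of the dense sequence. *)
have iVq n : D.-integrable setT (EFin \o (fun e => `|S e (q n) - q n| ^+ 2)).
  by have := integrable_noise hdot hsep Sne mS ST Tp0 iVp0 (q n); rewrite Fq.
have res := skm_residual_cvg hdot hsep Sne mS ST hlaw hindep x0 lambda0 lambda_le
  kappa1 lambda_sqr Tp0 iVp0 lambda_div.
have dist := ae_foralln (fun n => skm_dist_cvg hdot hsep Sne mS ST hlaw hindep x0
  lambda0 lambda_le kappa1 lambda_sqr (Fq n) (iVq n)).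
apply: filterS2 res dist => w res dist; split => //.
apply: (opial hdot) => //; first exact: (mean_operator_nonexpansive hdot Sne ST).
move=> p Fp; apply: (@cvg_dist_dense _ _ _ (range q)).
  by move=> _ [n _ <-]; exact: dist.
move=> e e0; have [n pn] := dq p Fp e e0.
by exists (q n) => //; exists n.
Qed.

Lemma eq_skm (R : realType) (H : normedModType R) (E Omega : Type)
    (S1 S2 : E -> H -> H) (lambda : nat -> R) (xi : nat -> Omega -> E) (x0 : H) w :
  (forall k, S1 (xi k w) = S2 (xi k w)) ->
  forall k, skm S1 lambda xi x0 k w = skm S2 lambda xi x0 k w.
Proof. by move=> S12; elim=> //= k ->; rewrite S12. Qed.

Theorem mainTheorem6 (R : realType)
    (H : completeNormedModType R) (dot : {dot H for @idfun R})
    (hdot : norm_of_dot dot) (hsep : separable_space H)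
    (dE : measure_display) (E : measurableType dE) (D : probability E R)
    (Tf : E -> H -> H)
    (hne : {ae D, forall e, nonexpansive (Tf e)})
    (hmeas : forall x : H, borel_measurable (fun e => Tf e x))
    (hint : forall x : H, bochner_integrable D (fun e => Tf e x))
    (hFix : fixed_points (mean_operator D Tf) !=set0)
    (sigma : R)
    (hsigma : exists2 p0 : H, fixed_points (mean_operator D Tf) p0 &
       (\int[D]_e (`|Tf e p0 - mean_operator D Tf p0| ^+ 2)%:E
          <= (sigma ^+ 2)%:E)%E)
    (lambda : nat -> R)
    (hlambda : forall k, 0 < lambda k < 1)
    (hlambda2 : (\sum_(0 <= k <oo) (lambda k ^+ 2)%:E < +oo)%E)
    (hlambda1 : (\sum_(0 <= k <oo) (lambda k)%:E = +oo)%E)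
    (x0 : H)
    (dO : measure_display) (Omega : measurableType dO)
    (P : probability Omega R) (xi : nat -> {RV P >-> E})
    (hlaw : forall k (A : set E), measurable A ->
       distribution P (xi k) A = D A)
    (hindep : mutually_independent xi) :
  let T := mean_operator D Tf in
  let x := skm Tf lambda (fun k => xi k) x0 in
  {ae P, forall w : Omega,
     (fun k => `|T (x k w) - x k w|) @ \oo --> (0 : R) /\
     exists2 p : H, fixed_points T p & weakly_converges dot (fun k => x k w) p}.
Proof.
move=> T x.
have mTf y : weakly_measurable dot (Tf ^~ y) by exact: borel_weakly_measurable.
have [N [mN DN subN]] := hne.
(* S is Tf modified on a null set so as to be nonexpansive for every e. *)
have TfN e : ~ N e -> nonexpansive (Tf e).
  by move=> Ne; apply: contrapT => h; apply: Ne; exact: subN.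
pose S e y := if e \in N then y else Tf e y.
have Sne e : nonexpansive (S e).
  by move=> y z; rewrite /S; case: ifPn => [//|]; rewrite notin_setE => /TfN.
have mmemN : measurable_fun setT (fun e => e \in N).
  apply: (measurable_fun_bool true); rewrite setTI.
  rewrite (_ : _ @^-1` _ = N)//; apply/seteqP.
  by split=> e /=; [exact: set_mem|exact: mem_set].
have dotS y z : (fun e => dot (S e y) z) =
    fun e => if e \in N then dot y z else dot (Tf e y) z.
  by apply/funext => e; rewrite /S; case: ifP.
have mS y : weakly_measurable dot (S ^~ y).
  by move=> z; rewrite dotS; apply: measurable_fun_ifT => //; exact: mTf.
have aeE (F G : E -> R) : (forall e, ~ N e -> F e = G e) ->
    ae_eq D setT (EFin \o F) (EFin \o G).
  move=> FG; exists N; split => // e /= h; apply: contrapT => Ne.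
  by apply: h => _; rewrite FG.
(* [T] is defined from [Tf], but inner products with it are integrals over D, which the change on
   the null set [N] leaves intact. *)
have ST y z : D.-integrable setT (EFin \o (fun e => dot (S e y) z)) /\
    dot (T y) z = \int[D]_e dot (S e y) z.
  have [i1 e1] := bochner_integral_dot hdot hsep z (mTf y) (hint y).
  have eqN e : ~ N e -> dot (S e y) z = dot (Tf e y) z.
    by move=> Ne; rewrite /S memNset.
  have mST : measurable_fun setT (EFin \o (fun e => dot (S e y) z)).
    exact/measurable_EFinP/mS.
  have mTT : measurable_fun setT (EFin \o (fun e => dot (Tf e y) z)).
    exact/measurable_EFinP/mTf.
  split; last first.
    rewrite /T /mean_operator e1 /Rintegral; congr fine.
    by apply: ae_eq_integral => //; apply: aeE => e /eqN.
  apply/integrableP; split => //; case/integrableP: i1 => _.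
  apply: le_lt_trans; rewrite le_eqVlt; apply/orP; left; apply/eqP.
  apply: ae_eq_integral => //; try exact: measurableT_comp.
  by apply: (aeE (fun e => `|dot (S e y) z|) (fun e => `|dot (Tf e y) z|)) => e /eqN ->.
have [p0 Tp0 hp0] := hsigma.
have iVp0 : D.-integrable setT (EFin \o (fun e => `|S e p0 - p0| ^+ 2)).
  have mV (F : E -> H -> H) : (forall y, weakly_measurable dot (F ^~ y)) ->
      measurable_fun setT (EFin \o (fun e => `|F e p0 - p0| ^+ 2)).
    move=> mF; apply/measurable_EFinP; apply: (measurable_sqr_norm hdot hsep).
    by apply: weakly_measurableB => //; exact: weakly_measurable_cst.
  apply/integrableP; split; first exact: mV.
  apply: le_lt_trans (ltry (sigma ^+ 2)); apply: le_trans hp0.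
  rewrite Tp0 le_eqVlt; apply/orP; left; apply/eqP.
  under eq_integral do rewrite gee0_abs ?lee_fin ?sqr_ge0//.
  apply: ae_eq_integral => //; [exact: mV|exact: mV|].
  by apply: aeE => e Ne; rewrite /S memNset.
have lambda0 k : 0 <= lambda k by case/andP: (hlambda k) => /ltW.
have [L lambdaL] := nneseries_lty_bounded (fun k => sqr_ge0 (lambda k)) hlambda2.
have lambda_div := nneseries_pinfty_unbounded lambda0 hlambda1.
(* Each xi_k has law D, so almost surely no sample ever falls in [N]; on this event [S] and [Tf]
   generate the same iterates. *)
have xiN : {ae P, forall w, forall k, ~ N (xi k w)}.
  apply: ae_foralln => k; exists (xi k @^-1` N); split.
  - exact: measurable_funPTI.
  - by have := hlaw k _ mN; rewrite DN.
  - by move=> w /contrapT.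
have := skm_ae_converges hdot hsep Sne mS ST hlaw hindep x0 hlambda lambdaL
  lambda_div Tp0 iVp0.
apply: filterS2 xiN => w Nw.
have -> : (fun k => `|T (x k w) - x k w|) = fun k =>
    `|T (skm S lambda (fun k => xi k) x0 k w) - skm S lambda (fun k => xi k) x0 k w|.
  apply/funext => k; rewrite (@eq_skm _ _ _ _ S Tf)// => j.
  by apply/funext => y; rewrite /S memNset//; exact: Nw.
have -> // : x ^~ w = (skm S lambda (fun k => xi k) x0)^~ w.
apply/funext => k; apply: eq_skm => j.
by apply/funext => y; rewrite /S memNset//; exact: Nw.
Qed.
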